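(* Let $E$ be an elliptic curve over a field $k$ of characteristic $0$. Let $\Gamma\subset E(\overline{k})$ be a finitely generated subgroup and let $\Gamma_0\subset E(\overline{k})$ be its saturation. Then there exists a finite extension $L/k$ with $[L:k]\le 18$ such that $E(L)\not\subset\Gamma_0$. Moreover, if $k$ is a number field, such an $L$ can be chosen with $[L:k]\le 2$.
   Context: For an abelian group $G$ and a subgroup $H$, the saturation of $H$ in $G$ is $\{g\in G:\ ng\in H\text{ for some nonzero } n\in\mathbb{Z}\}$. *)

(* Defs.v *)
From HB Require Import structures.
From mathcomp Require Import all_boot all_order all_algebra all_field.
From mathcomp Require Import ring.

Set Implicit Arguments.
Unset Strict Implicit.
Unset Printing Implicit Defensive.

Import GRing.Theory.
Local Open Scope ring_scope.

(* Elliptic curves are given by general Weierstrass equations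
     y^2 + a1 x y + a3 y = x^3 + a2 x^2 + a4 x + a6
   with nonzero discriminant. *)
Record weierstrass (K : Type) := Weierstrass {
  a1 : K; a2 : K; a3 : K; a4 : K; a6 : K
}.

Definition discriminant (K : fieldType) (W : weierstrass K) : K :=
  let b2 := a1 W ^+ 2 + 4%:R * a2 W in
  let b4 := 2%:R * a4 W + a1 W * a3 W in
  let b6 := a3 W ^+ 2 + 4%:R * a6 W in
  let b8 := a1 W ^+ 2 * a6 W + 4%:R * a2 W * a6 W - a1 W * a3 W * a4 W
            + a2 W * a3 W ^+ 2 - a4 W ^+ 2 in
  - b2 ^+ 2 * b8 - 8%:R * b4 ^+ 3 - 27%:R * b6 ^+ 2 + 9%:R * b2 * b4 * b6.

Record elliptic_curve (K : fieldType) := EllipticCurve {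
  equation :> weierstrass K;
  discriminant_neq0 : discriminant equation != 0
}.

Section BaseChange.
Variables (K L : fieldType) (f : {rmorphism K -> L}) (E : elliptic_curve K).

Definition map_weierstrass : weierstrass L :=
  Weierstrass (f (a1 E)) (f (a2 E)) (f (a3 E)) (f (a4 E)) (f (a6 E)).

Lemma base_change_subproof : discriminant map_weierstrass != 0.
Proof.
suff -> : discriminant map_weierstrass = f (discriminant E).
  by rewrite fmorph_eq0 discriminant_neq0.
rewrite /discriminant /=; ring.
Qed.

Definition base_change : elliptic_curve L := EllipticCurve base_change_subproof.
End BaseChange.

(* [None] is the point at infinity, [Some (x, y)] an affine point. *)
Definition on_curve (K : fieldType) (E : elliptic_curve K)
    (P : option (K * K)) : bool :=
  if P is Some (x, y) then
    y ^+ 2 + a1 E * x * y + a3 E * y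
      == x ^+ 3 + a2 E * x ^+ 2 + a4 E * x + a6 E
  else true.

(* The set E(K) of K-rational points. *)
Record point (K : fieldType) (E : elliptic_curve K) := Point {
  coords :> option (K * K);
  coords_on_curve : on_curve E coords
}.

HB.instance Definition _ (K : fieldType) (E : elliptic_curve K) :=
  [isSub for @coords K E].
HB.instance Definition _ (K : fieldType) (E : elliptic_curve K) :=
  [Choice of point E by <:].

Section GroupLaw.
Variables (K : fieldType) (E : elliptic_curve K).

Definition opp_coords (P : option (K * K)) : option (K * K) :=
  if P is Some (x, y) then Some (x, - y - a1 E * x - a3 E) else None.

(* Slope of the chord through the two points, or of the tangent if they have
   the same abscissa. *)
Definition slope (x1 y1 x2 y2 : K) : K :=
  if x1 == x2
  then (3%:R * x1 ^+ 2 + 2%:R * a2 E * x1 + a4 E - a1 E * y1)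
         / (2%:R * y1 + a1 E * x1 + a3 E)
  else (y2 - y1) / (x2 - x1).

Definition add_coords (P Q : option (K * K)) : option (K * K) :=
  match P, Q with
  | None, _ => Q
  | _, None => P
  | Some (x1, y1), Some (x2, y2) =>
    if (x1 == x2) && (y1 == - y2 - a1 E * x2 - a3 E) then None
    else
      let l := slope x1 y1 x2 y2 in
      let x3 := l ^+ 2 + a1 E * l - a2 E - x1 - x2 in
      Some (x3, - (l * (x3 - x1) + y1) - a1 E * x3 - a3 E)
  end.

Lemma opp_subproof (P : point E) : on_curve E (opp_coords P).
Proof.
case: P => -[[x y]|] //= /eqP h; apply/eqP; rewrite -h; ring.
Qed.

Lemma add_subproof (P Q : point E) : on_curve E (add_coords P Q).
Proof.
case: P => -[[x1 y1]|] //= h1; case: Q => -[[x2 y2]|] //= h2.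
move/eqP: h1 => h1; move/eqP: h2 => h2.
have e6 : a6 E = y1 ^+ 2 + a1 E * x1 * y1 + a3 E * y1
   - (x1 ^+ 3 + a2 E * x1 ^+ 2 + a4 E * x1) by rewrite h1; ring.
case: (x1 =P x2) => [ex|/eqP nx] /=; last first.
  have nx' : x2 - x1 != 0 by rewrite subr_eq0 eq_sym.
  have e4 : a4 E = (y2 ^+ 2 + a1 E * x2 * y2 + a3 E * y2 - x2 ^+ 3
     - a2 E * x2 ^+ 2 - (y1 ^+ 2 + a1 E * x1 * y1 + a3 E * y1
     - x1 ^+ 3 - a2 E * x1 ^+ 2)) / (x2 - x1).
    by apply: (canRL (mulfK nx')); rewrite h1 h2; ring.
  rewrite /slope (negPf nx); apply/eqP; rewrite e6 e4; field.
  exact: nx'.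
subst x2; case: eqP => //= /eqP ny.
have e12 : y1 = y2.
  have : (y1 - y2) * (y1 - (- y2 - a1 E * x1 - a3 E)) = 0.
    transitivity (y1 ^+ 2 + a1 E * x1 * y1 + a3 E * y1
      - (y2 ^+ 2 + a1 E * x1 * y2 + a3 E * y2)); first by ring.
    by rewrite h1 h2 subrr.
  by move/eqP; rewrite mulf_eq0 !subr_eq0 (negPf ny) orbF => /eqP.
subst y2; rewrite /slope eqxx.
have nd : 2%:R * y1 + a1 E * x1 + a3 E != 0.
  have -> : 2%:R * y1 + a1 E * x1 + a3 E = y1 - (- y1 - a1 E * x1 - a3 E)
    by ring.
  by rewrite subr_eq0.
apply/eqP; rewrite e6; field.
exact: nd.
Qed.

Definition point_zero : point E := @Point K E None isT.
Definition point_opp (P : point E) : point E := Point (opp_subproof P).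
Definition point_add (P Q : point E) : point E := Point (add_subproof P Q).
End GroupLaw.

(* The chord-and-tangent operations on E(K). Only the operations are declared
   here: [baseZmodType] carries no axioms. *)
HB.instance Definition _ (K : fieldType) (E : elliptic_curve K) :=
  Algebra.hasAdd.Build (point E) (@point_add K E).
HB.instance Definition _ (K : fieldType) (E : elliptic_curve K) :=
  Algebra.hasZero.Build (point E) (@point_zero K E).
HB.instance Definition _ (K : fieldType) (E : elliptic_curve K) :=
  Algebra.hasOpp.Build (point E) (@point_opp K E).

Section PointMap.
Variables (k L K : fieldType) (E : elliptic_curve k).
Variables (f : {rmorphism k -> L}) (g : {rmorphism k -> K}).
Variables (j : {rmorphism L -> K}) (jf : forall a, j (f a) = g a).

Lemma point_map_subproof (P : point (base_change f E)) :
  on_curve (base_change g E) (omap (fun xy => (j xy.1, j xy.2)) (coords P)).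
Proof.
case: P => -[[x y]|] //= /eqP h; apply/eqP.
rewrite -!jf.
transitivity (j (x ^+ 3 + f (a2 E) * x ^+ 2 + f (a4 E) * x + f (a6 E))).
  by rewrite -h; ring.
by ring.
Qed.

(* The map E(L) -> E(K) induced by a k-embedding j : L -> K. *)
Definition point_map (P : point (base_change f E)) : point (base_change g E) :=
  Point (point_map_subproof P).
End PointMap.

Section Subgroups.
Variable G : baseZmodType.
Implicit Types H : G -> Prop.

Definition is_subgroup H : Prop :=
  [/\ H 0, forall x y, H x -> H y -> H (x + y) & forall x, H x -> H (- x)].

Definition generated (n : nat) (g : 'I_n -> G) (x : G) : Prop :=
  forall H, is_subgroup H -> (forall i, H (g i)) -> H x.

Definition finitely_generated H : Prop :=
  exists (n : nat) (g : 'I_n -> G), forall x, H x <-> generated g x.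

(* [x *~ n] is only available on a [zmodType]. *)
Definition zmul (x : G) (n : int) : G :=
  match n with Posz m => x *+ m | Negz m => - (x *+ m.+1) end.

Definition saturation H (x : G) : Prop := exists n : int, n != 0 /\ H (zmul x n).
End Subgroups.

Definition is_algebraic_closure (k : fieldType) (kbar : closedFieldType)
    (iota : {rmorphism k -> kbar}) : Prop :=
  forall x : kbar, algebraicOver iota x.

Definition number_field (k : fieldType) : Prop :=
  exists (F : fieldExtType rat) (phi : {rmorphism F -> k}), bijective phi.

(* There is a finite extension L / k inside kbar (via j) with [L : k] <= d and
   E(L) not contained in S. *)
Definition has_extension_escaping (k : fieldType) (kbar : closedFieldType)
    (iota : {rmorphism k -> kbar}) (E : elliptic_curve k)
    (S : point (base_change iota E) -> Prop) (d : nat) : Prop :=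
  exists (L : fieldExtType k) (j : {rmorphism L -> kbar})
         (jk : forall a : k, j (in_alg L a) = iota a),
    (\dim {:L} <= d)%N /\
    ~ (forall P : point (base_change (in_alg L) E), S (point_map jk P)).

(* Main.v *)
From HB Require Import structures.
From mathcomp Require Import all_boot all_order all_algebra all_field.
From mathcomp Require Import ring boolp classical_sets.
Require Import Defs.

Set Implicit Arguments.
Unset Strict Implicit.
Unset Printing Implicit Defensive.

Import GRing.Theory.
Local Open Scope classical_set_scope.
Local Open Scope ring_scope.

(** The bound 2 holds over every field of characteristic 0. Completing the
    square, write the curve as y^2 = f(x) and consider the points
    P = (x, sqrt (f x)) with x in k. Let KK be a finitely generated field
    containing the coefficients of f and the coordinates of generators of Gamma.
    If s = sqrt (f x) is not in KK, then every multiple of P has the form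
    (a, b s) with a, b in KK, so n P in Gamma forces n P = - n P: it suffices to
    find x such that s is not in KK and P is not torsion. Take x = 1 / (4 p c).

    Not torsion: fix a valuation ring O of kbar in which 2 is not a unit, and c
    such that c f has coefficients in O. The duplication formula shows that
    1 / x (2^i P) is 4^i / x (P) up to a unit of O, so the points 2^i P are
    distinct.

    Not in KK: for a suitable prime p not dividing 2 c, f x = p^(-3) * unit would
    be a square in a field which is unramified at p. To make sense of this, KK
    is written as F(z) with F purely transcendental over the rationals; places
    of F over p are obtained from reduction modulo p by specialising the
    transcendental generators one by one at integers, and z is chosen integral
    with separable reduction. *)

(** * The group law on a cubic y^2 = x^3 + A x^2 + B x + C *)

Section ShortCurve.
Variables (K : fieldType) (A B C : K).
Implicit Types P Q S R U : option (K * K).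

Definition cubic (x : K) := x ^+ 3 + A * x ^+ 2 + B * x + C.
Definition dcubic (x : K) := 3%:R * x ^+ 2 + 2%:R * A * x + B.

Definition on_cubic P := if P is Some (x, y) then y ^+ 2 == cubic x else true.
Definition neg P := if P is Some (x, y) then Some (x, - y) else None.

Definition chord (x1 y1 x2 y2 : K) : K :=
  if x1 == x2 then dcubic x1 / (2%:R * y1) else (y2 - y1) / (x2 - x1).

Definition add P Q :=
  match P, Q with
  | None, _ => Q
  | _, None => P
  | Some (x1, y1), Some (x2, y2) =>
    if (x1 == x2) && (y1 == - y2) then None
    else
      let l := chord x1 y1 x2 y2 in
      let x3 := l ^+ 2 - A - x1 - x2 in
      Some (x3, - (l * (x3 - x1) + y1))
  end.

Lemma addp0 P : add P None = P. Proof. by case: P => [[]|]. Qed.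

Lemma negK : involutive neg.
Proof. by case=> [[x y]|] //=; rewrite opprK. Qed.

Lemma on_neg P : on_cubic (neg P) = on_cubic P.
Proof. by case: P => [[x y]|] //=; rewrite sqrrN. Qed.

Hypothesis two_neq0 : 2%:R != 0 :> K.
Hypothesis smooth : forall e, cubic e = 0 -> dcubic e != 0.

Lemma on_same_abscissa x y y' :
  y ^+ 2 = cubic x -> y' ^+ 2 = cubic x -> y != - y' -> y = y'.
Proof.
move=> e e' ne; have : (y - y') * (y + y') = 0.
  by rewrite -subr_sqr e e' subrr.
by move/eqP; rewrite mulf_eq0 subr_eq0 addr_eq0 (negPf ne) orbF => /eqP.
Qed.

Lemma double_neq0 (y : K) : y != - y -> y != 0.
Proof. by apply: contraNneq => ->; rewrite oppr0. Qed.

Lemma eq_oppr0 (y : K) : (y == - y) = (y == 0).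
Proof.
by rewrite -addr_eq0 -mulr2n -mulr_natl mulf_eq0 (negPf two_neq0).
Qed.

(* The three identities say that the cubic minus the square of l X + m has
   roots x1, x2, x3; this description does not distinguish chords from
   tangents. *)
Definition on_line (l m x1 x2 x3 : K) :=
  [/\ A = l ^+ 2 - (x1 + x2 + x3),
      B = 2%:R * l * m + (x1 * x2 + x1 * x3 + x2 * x3)
    & C = m ^+ 2 - x1 * x2 * x3].

Lemma on_line_rot l m x1 x2 x3 : on_line l m x1 x2 x3 -> on_line l m x3 x2 x1.
Proof. by case=> a b c; split; rewrite ?a ?b ?c; ring. Qed.

Lemma on_line_opp l m x1 x2 x3 :
  on_line l m x1 x2 x3 -> on_line (- l) (- m) x1 x2 x3.
Proof. by case=> a b c; split; rewrite ?a ?b ?c; ring. Qed.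

Lemma on_lineE l m x1 x2 x3 t : on_line l m x1 x2 x3 ->
  cubic t = (l * t + m) ^+ 2 + (t - x1) * (t - x2) * (t - x3).
Proof. by case=> a b c; rewrite /cubic a b c; ring. Qed.

Lemma on_line_tangent l m x1 x3 : on_line l m x1 x1 x3 ->
  dcubic x1 = 2%:R * (l * x1 + m) * l.
Proof. by case=> a b c; rewrite /dcubic a b; ring. Qed.

(** Once the line is known by its equation, the chord and tangent formulas agree; later proofs are
    thereby freed from that case distinction. *)
Lemma add_line l m x1 x2 x3 : on_line l m x1 x2 x3 ->
  add (Some (x1, l * x1 + m)) (Some (x2, l * x2 + m))
    = Some (x3, - (l * x3 + m)).
Proof.
move=> hl; rewrite /add.
have sl : (x1 == x2) && (l * x1 + m == - (l * x2 + m)) = false /\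
    chord x1 (l * x1 + m) x2 (l * x2 + m) = l.
  rewrite /chord; case: eqP => [e | /eqP ne] /=; last first.
    by split=> //; field; rewrite subr_eq0 eq_sym.
  move: hl; rewrite -e => hl; rewrite eq_oppr0.
  have y0 : l * x1 + m != 0.
    (* A double root with ordinate zero would be a singular point. *)
    apply/eqP => y0; have := on_line_tangent hl; have := on_lineE x1 hl.
    rewrite y0 subrr !mul0r expr0n addr0 => /smooth /negP h d.
    by apply: h; rewrite d mulr0 mul0r.
  by split; [apply: negPf | rewrite (on_line_tangent hl); field; apply/andP].
case: sl => -> ->; have -> : l ^+ 2 - A - x1 - x2 = x3.
  by case: hl => -> _ _; ring.
by congr (Some (_, _)); ring.
Qed.

Lemma add_lineP x1 y1 x2 y2 :
  y1 ^+ 2 = cubic x1 -> y2 ^+ 2 = cubic x2 ->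
  ~~ ((x1 == x2) && (y1 == - y2)) ->
  exists l m x3, [/\ on_line l m x1 x2 x3, y1 = l * x1 + m, y2 = l * x2 + m &
    add (Some (x1, y1)) (Some (x2, y2)) = Some (x3, - (l * x3 + m))].
Proof.
move=> h1 h2 nopp.
pose l := chord x1 y1 x2 y2; pose m := y1 - l * x1.
pose x3 := l ^+ 2 - A - x1 - x2.
suff [hl e2] : on_line l m x1 x2 x3 /\ y2 = l * x2 + m.
  have e1 : y1 = l * x1 + m by rewrite /m; ring.
  exists l, m, x3; split=> //; rewrite {1}e1 {1}e2; exact: add_line.
(* Solving for [C] by the first point, and for [B] by the tangent slope or by the second point,
   turns the three identities into identities of rational functions. *)
have eC : C = y1 ^+ 2 - x1 ^+ 3 - A * x1 ^+ 2 - B * x1.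
  by rewrite h1 /cubic; ring.
move: nopp; rewrite /x3 /m /l /chord; case: eqP => [e | /eqP ne] /=.
  subst x2 => ny; have e2 := on_same_abscissa h1 h2 ny; subst y2.
  have y0 := double_neq0 ny.
  split; last by field; apply/andP.
  have eB : B = dcubic x1 - 3%:R * x1 ^+ 2 - 2%:R * A * x1.
    by rewrite /dcubic; ring.
  split; first by field; apply/andP.
    by rewrite {1}eB; field; apply/andP.
  by rewrite eC {1}eB; field; apply/andP.
move=> _; have d0 : x2 - x1 != 0 by rewrite subr_eq0 eq_sym.
have eB : B = (y2 ^+ 2 - y1 ^+ 2 - (x2 ^+ 3 - x1 ^+ 3)
               - A * (x2 ^+ 2 - x1 ^+ 2)) / (x2 - x1).
  by rewrite h1 h2 /cubic; field.
split; last by field.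
split; first by field.
  by rewrite eB; field.
by rewrite eC eB; field.
Qed.

Lemma on_add P Q : on_cubic P -> on_cubic Q -> on_cubic (add P Q).
Proof.
case: P => [[x1 y1]|] //; case: Q => [[x2 y2]|] // /eqP h1 /eqP h2.
case: (boolP ((x1 == x2) && (y1 == - y2))) => [h|h]; first by rewrite /= h.
have [l [m [x3 [hl _ _ ->]]]] := add_lineP h1 h2 h.
by rewrite /= sqrrN (on_lineE x3 hl) subrr mulr0 addr0.
Qed.

Lemma addpN P : add P (neg P) = None.
Proof. by case: P => [[x y]|] //=; rewrite opprK !eqxx. Qed.

Lemma addNp P : add (neg P) P = None.
Proof. by case: P => [[x y]|] //=; rewrite !eqxx. Qed.

Lemma addC P Q : on_cubic P -> on_cubic Q -> add P Q = add Q P.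
Proof.
case: P => [[x1 y1]|]; last by rewrite addp0.
case: Q => [[x2 y2]|] // /eqP h1 /eqP h2.
case: (boolP ((x1 == x2) && (y1 == - y2))) => [/andP[/eqP <- /eqP ->]|h].
  exact: etrans (addNp (Some (x1, y2))) (esym (addpN (Some (x1, y2)))).
have [l [m [x3 [hl e1 e2 ->]]]] := add_lineP h1 h2 h.
rewrite e1 e2 (@add_line _ _ _ _ x3) //.
by case: hl => a b c; split; rewrite ?a ?b ?c; ring.
Qed.

Lemma negD P Q : neg (add P Q) = add (neg P) (neg Q).
Proof.
case: P => [[x1 y1]|] //; case: Q => [[x2 y2]|] //=.
rewrite eqr_opp; case: ifP => // _; rewrite /neg.
have -> : chord x1 (- y1) x2 (- y2) = - chord x1 y1 x2 y2.
  rewrite /chord; case: ifP => _; last by rewrite -opprD mulNr.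
  by rewrite mulrN invrN mulrN.
by rewrite sqrrN; congr (Some (_, _)); ring.
Qed.

(** Collinearity is symmetric: the reflection of the line through P and Q meets the curve in P + Q,
    - Q and - P. *)
Lemma addpK P Q : on_cubic P -> on_cubic Q -> add (add P Q) (neg Q) = P.
Proof.
case: P => [[x1 y1]|]; last by move=> _ _; exact: addpN.
case: Q => [[x2 y2]|] // /eqP h1 /eqP h2.
case: (boolP ((x1 == x2) && (y1 == - y2))) => [h|h].
  by rewrite /= h; case/andP: h => /eqP -> /eqP ->.
have [l [m [x3 [hl e1 e2 ->]]]] := add_lineP h1 h2 h.
have := add_line (on_line_opp (on_line_rot hl)).
rewrite e1 e2 /neg => e; transitivity (Some (x1, - (- l * x1 - m))).
  by rewrite -e; congr add; congr (Some (_, _)); ring.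
by congr (Some (_, _)); ring.
Qed.

Definition abscissa P := omap fst P.

Lemma abscissa_eq P Q : on_cubic P -> on_cubic Q ->
  abscissa P = abscissa Q -> P = Q \/ P = neg Q.
Proof.
case: P => [[x1 y1]|]; case: Q => [[x2 y2]|] //=; last by left.
move=> /eqP h1 /eqP h2 [e]; subst x2.
case: (y1 =P - y2) => [->|/eqP /(on_same_abscissa h1 h2) ->]; by [right|left].
Qed.

Lemma abscissa_neq P Q : on_cubic P -> on_cubic Q ->
  P <> Q -> P <> neg Q -> abscissa P <> abscissa Q.
Proof. by move=> hP hQ n1 n2 /(abscissa_eq hP hQ) []. Qed.

(* Here x12 is the abscissa of P + Q, where Q = (x1 + h, y1 + l h) and l is the
   slope of the chord, or tangent, through P = (x1, y1) and Q, while
   S = (x1 + k, y1 + m k). *)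
Lemma addA_generic_identity (x1 y1 l m h k x12 a l23 x23 y23 la lb X : K) :
  k - h != 0 -> x1 + k - x12 != 0 -> x23 - x1 != 0 ->
  (x1 + k - x12) * (k - h) = (m - l) * (k * (l + m) + 2%:R * y1) ->
  a = l ^+ 2 - (x1 + (x1 + h) + x12) ->
  l23 = (m * k - l * h) / (k - h) ->
  x23 = l23 ^+ 2 - a - (x1 + h) - (x1 + k) ->
  y23 = - (l23 * (x23 - (x1 + h)) + (y1 + l * h)) ->
  la = (y1 + m * k + (l * (x12 - x1) + y1)) / (x1 + k - x12) ->
  lb = (y23 - y1) / (x23 - x1) ->
  X = lb ^+ 2 - a - x1 - x23 ->
  la ^+ 2 - a - x12 - (x1 + k) = X /\
  - (la * (X - x12) - (l * (x12 - x1) + y1)) = - (lb * (X - x1) + y1).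
Proof.
move=> kh n1 n2 e ea el23 ex23 ey23 ela elb eX.
(* Through the relation [e], every quantity becomes a fraction in [x1], [y1], [l], [m], [h], [k]. *)
have e12 : x1 + k - x12 = (m - l) * (k * (l + m) + 2%:R * y1) / (k - h).
  by rewrite -e mulfK.
have e12' : x12 = x1 + k - (m - l) * (k * (l + m) + 2%:R * y1) / (k - h).
  by rewrite -e12; ring.
have e23 : x23 - x1 =
    (m - l) * ((m - l) * h * k - (k - h) * 2%:R * y1) / (k - h) ^+ 2.
  by rewrite ex23 el23 ea e12'; field.
have e23' : x23 = x1 +
    (m - l) * ((m - l) * h * k - (k - h) * 2%:R * y1) / (k - h) ^+ 2.
  by rewrite -e23; ring.
(* The two nonzero differences of abscissas factor, and their factors are the denominators to be
   cleared. *)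
have /andP[n3 n4] : (m - l != 0) && (k * (l + m) + 2%:R * y1 != 0).
  by move: n1; rewrite e12 !mulf_eq0 !negb_or => /andP[/andP[-> ->]].
have n5 : (m - l) * h * k - (k - h) * 2%:R * y1 != 0.
  by move: n2; rewrite e23 !mulf_eq0 !negb_or => /andP[/andP[_ ->]].
rewrite eX ela elb ey23 e12 e23 e23' e12' ea e12' el23; clear - kh n3 n4 n5.
by split; field; rewrite n3 n4 n5 kh.
Qed.

Lemma add_distinct x1 y1 x2 y2 l x3 : x1 != x2 ->
  l = (y2 - y1) / (x2 - x1) -> x3 = l ^+ 2 - A - x1 - x2 ->
  add (Some (x1, y1)) (Some (x2, y2)) = Some (x3, - (l * (x3 - x1) + y1)).
Proof. by move=> ne -> ->; rewrite /= /chord (negPf ne). Qed.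

(** Every addition is a chord except P + Q, which may be a tangent: [add_lineP] treats both at once.
    This is what makes the case of two equal neighbours accessible in [addA]. *)
Lemma addA_generic P Q S : on_cubic P -> on_cubic Q -> on_cubic S ->
  P <> None -> Q <> None -> S <> None -> P <> neg Q ->
  abscissa P <> abscissa S -> abscissa Q <> abscissa S ->
  abscissa (add P Q) <> abscissa S -> abscissa P <> abscissa (add Q S) ->
  add (add P Q) S = add P (add Q S).
Proof.
case: P => [[x1 y1]|] //; case: Q => [[x2 y2]|] //; case: S => [[x3 y3]|] //.
move=> /eqP h1 /eqP h2 /eqP h3 _ _ _ npq n13 n23.
have {}n13 : x1 != x3 by apply/eqP => e; apply: n13; rewrite e.
have {}n23 : x2 != x3 by apply/eqP => e; apply: n23; rewrite e.
have nopp : ~~ ((x1 == x2) && (y1 == - y2)).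
  by apply/negP => /andP[/eqP e1 /eqP e2]; apply: npq; rewrite e1 e2.
have [l [c [x12 [hl e1 e2 ->]]]] := add_lineP h1 h2 nopp.
pose l23 := (y3 - y2) / (x3 - x2); pose x23 := l23 ^+ 2 - A - x2 - x3.
pose y23 := - (l23 * (x23 - x2) + y2).
rewrite (@add_distinct _ _ _ _ l23 x23 n23) // => n123 n123'.
have m1 : x12 != x3 by apply/eqP => e; apply: n123; rewrite e.
have m2 : x1 != x23 by apply/eqP => e; apply: n123'; rewrite e.
rewrite (add_distinct m1 erefl erefl) (add_distinct m2 erefl erefl).
pose h := x2 - x1; pose k := x3 - x1; pose m := (y3 - y1) / k.
have k0 : k != 0 by rewrite subr_eq0 eq_sym.
have kh : k - h != 0.
  by rewrite (_ : k - h = x3 - x2) ?subr_eq0 1?eq_sym // /k /h; ring.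
have ex2 : x2 = x1 + h by rewrite /h; ring.
have ex3 : x3 = x1 + k by rewrite /k; ring.
have ey2 : y2 = y1 + l * h by rewrite e1 e2 /h; ring.
have ey3 : y3 = y1 + m * k by rewrite /m; field.
have [] := @addA_generic_identity x1 y1 l m h k x12 A l23 x23 y23
  ((y3 - - (l * x12 + c)) / (x3 - x12)) ((y23 - y1) / (x23 - x1))
  (((y23 - y1) / (x23 - x1)) ^+ 2 - A - x1 - x23) => //.
- by rewrite -ex3 subr_eq0 eq_sym.
- by rewrite subr_eq0 eq_sym.
(* The required relation is [on_lineE] at the abscissa of S, where the cubic equals [y3 ^+ 2],
   divided by [k]. *)
- have := on_lineE x3 hl; rewrite -h3.
  have -> : l * x3 + c = y1 + l * k by rewrite e1 /k; ring.
  rewrite ey3 => /eqP; rewrite -subr_eq0 => /eqP ee.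
  apply: (mulfI k0); apply/eqP; rewrite -subr_eq0 -oppr_eq0 -ee -ex3.
  by apply/eqP; rewrite /k /h; ring.
- by rewrite -ex2; case: hl.
- by rewrite /l23; congr (_ / _); rewrite ?ey3 ?ey2 ?ex3 ?ex2; ring.
- by rewrite /x23 -ex2 -ex3.
- by rewrite /y23 -ex2 -ey2.
- by rewrite -ex3 -ey3; congr (_ / _); rewrite e1; ring.
rewrite -ex3 => -> <-; congr (Some (_, _)); rewrite e1; ring.
Qed.

(** Coordinates are translated so that R = (0, y) and U = (d, y'). Here [l] and [l'] are the slopes
    for R + U and R - U, [m] is the slope of the chord through these two sums, and [t] that of the
    tangent at R. *)
Lemma add_add_sub_identity (y d y' a b t l l' X X' m : K) :
  y != 0 -> y' != 0 -> d != 0 ->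
  b = (y' ^+ 2 - y ^+ 2) / d - d ^+ 2 - a * d ->
  t = b / (2%:R * y) ->
  l = (y' - y) / d -> l' = (- y' - y) / d ->
  X = l ^+ 2 - a - d -> X' = l' ^+ 2 - a - d ->
  m = (- (l' * X' + y) + (l * X + y)) / (X' - X) ->
  m ^+ 2 - a - X - X' = t ^+ 2 - a /\
  - (m * (t ^+ 2 - a - X) - (l * X + y)) = - (t * (t ^+ 2 - a) + y).
Proof.
move=> y0 y'0 d0 eb et el el' eX eX' em.
have eXX : X' - X = 4%:R * y * y' / d ^+ 2 by rewrite eX eX' el el'; field.
have four : 4%:R != 0 :> K.
  by rewrite (_ : 4%:R = 2%:R * 2%:R) ?mulf_neq0 // -natrM.
rewrite em eXX eX eX' et el el' eb; clear - y0 y'0 d0 four two_neq0.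
by split; field; rewrite ?y0 ?y'0 ?d0 ?four ?two_neq0.
Qed.

(** The 2-torsion point is placed at the origin, and (X, Y) is its sum with (x, y); the two points
    have the same double. *)
Lemma double_add_two_torsion_identity (x y a b t t' X Y : K) :
  y != 0 -> x != 0 -> b != 0 ->
  y ^+ 2 = x ^+ 3 + a * x ^+ 2 + b * x ->
  t = (3%:R * x ^+ 2 + 2%:R * a * x + b) / (2%:R * y) ->
  X = b / x -> Y = - (y * b / x ^+ 2) ->
  t' = (3%:R * X ^+ 2 + 2%:R * a * X + b) / (2%:R * Y) ->
  t' ^+ 2 - a - X - X = t ^+ 2 - a - x - x /\
  - (t' * (t ^+ 2 - a - x - x - X) + Y) = - (t * (t ^+ 2 - a - x - x - x) + y).
Proof.
move=> y0 x0 b0 e et eX eY et'.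
have ea : a = (y ^+ 2 - x ^+ 3 - b * x) / x ^+ 2 by rewrite e; field.
rewrite et' eY eX et ea; clear - y0 x0 b0 two_neq0.
by split; field; rewrite ?oppr_eq0 ?mulf_neq0 ?y0 ?x0 ?two_neq0.
Qed.

Lemma add_double x y : y != 0 ->
  add (Some (x, y)) (Some (x, y)) =
  let t := dcubic x / (2%:R * y) in
  Some (t ^+ 2 - A - x - x, - (t * (t ^+ 2 - A - x - x - x) + y)).
Proof. by move=> y0; rewrite /= eqxx eq_oppr0 (negPf y0) /chord eqxx. Qed.

(** When U is 2-torsion, R + U and R - U coincide and the chord of [add_add_sub_identity]
    degenerates to a tangent; hence this separate computation. *)
Lemma double_add_two_torsion x y x' :
  y ^+ 2 = cubic x -> 0 = cubic x' -> x != x' -> y != 0 ->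
  let R := Some (x, y) in let U := Some (x', 0) in
  add (add R U) (add R U) = add R R.
Proof.
move=> h h' ne y0 R U.
have hR : on_cubic R by apply/eqP.
have hU : on_cubic U by apply/eqP; rewrite expr0n.
have h0 : 0 ^+ 2 = cubic x' by rewrite expr0n.
have nopp : ~~ ((x == x') && (y == - 0)) by rewrite (negPf ne).
have [l [m [X [hl e1 e2 e]]]] := add_lineP h h0 nopp.
have d0 : x - x' != 0 by rewrite subr_eq0.
have el : l = y / (x - x').
  by rewrite (_ : y = l * (x - x')) ?mulfK // -[LHS]subr0 {1}e2 {1}e1; ring.
have em : m = - l * x' by apply/eqP; rewrite mulNr -addr_eq0 addrC -e2.
(* Taylor coefficients of the cubic at [x'], so that the curve becomes y^2 = X^3 + a X^2 + b X. *)
pose a := A + 3%:R * x'; pose b := dcubic x'.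
have b0 : b != 0 by exact: smooth.
pose Y := - (l * X + m).
have eRU : add R U = Some (X, Y) by [].
have ey : y ^+ 2 = (x - x') ^+ 3 + a * (x - x') ^+ 2 + b * (x - x').
  transitivity (y ^+ 2 - cubic x'); first by rewrite -h' subr0.
  by rewrite h /cubic /a /b /dcubic; ring.
have eX : X - x' = b / (x - x').
  have -> : X - x' = l ^+ 2 - a - (x - x').
    by case: hl => eA _ _; rewrite /a eA; ring.
  by rewrite el expr_div_n ey; field.
have eY : Y = - (y * b / (x - x') ^+ 2).
  have -> : Y = - (l * (X - x')) by rewrite /Y em; ring.
  by rewrite eX el; field.
have Y0 : Y != 0.
  by rewrite eY oppr_eq0 !mulf_neq0 ?invr_eq0 ?expf_neq0.
rewrite eRU !add_double //=.
have [] := @double_add_two_torsion_identity (x - x') y a b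
  (dcubic x / (2%:R * y)) (dcubic X / (2%:R * Y)) (X - x') Y => //.
- by congr (_ / _); rewrite /dcubic /a /b /dcubic; ring.
- by congr (_ / _); rewrite /dcubic /a /b /dcubic; ring.
set t' := _ / _; set t := _ / _ => e3 e4.
have {}e3 : t' ^+ 2 - A - X - X = t ^+ 2 - A - x - x.
  transitivity (t' ^+ 2 - a - (X - x') - (X - x') + x'); first by rewrite /a; ring.
  by rewrite e3 /a; ring.
rewrite e3; congr (Some (_, _)).
transitivity (- (t' * (t ^+ 2 - a - (x - x') - (x - x') - (X - x')) + Y)).
  by rewrite /a; ring.
by rewrite e4 /a; ring.
Qed.

Lemma add_add_sub R U : on_cubic R -> on_cubic U ->
  abscissa R <> abscissa U -> add (add R U) (add R (neg U)) = add R R.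
Proof.
case: R => [[x y]|]; last by rewrite /= => _ _ _; exact: addpN.
case: U => [[x' y']|] hR hU ne; last by rewrite !addp0.
have {}ne : x != x' by apply/eqP => e; apply: ne; rewrite e.
move/eqP: (hR) => h; move/eqP: (hU) => h'.
(* If R is its own opposite, then R - U = - (R + U) and both sides are zero. *)
have [y0|y0] := eqVneq y 0.
  have eR : Some (x, y) = neg (Some (x, y)) by rewrite /= y0 oppr0.
  by rewrite [in add _ (neg _)]eR -negD addpN {2}eR addpN.
have [y'0|y'0] := eqVneq y' 0.
  have -> : neg (Some (x', y')) = Some (x', y') by rewrite /= y'0 oppr0.
  by rewrite y'0 double_add_two_torsion // -h' y'0 expr0n.
pose d := x' - x; have d0 : d != 0 by rewrite subr_eq0 eq_sym.
pose a := A + 3%:R * x.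
pose l := (y' - y) / d; pose l' := (- y' - y) / d.
pose X := l ^+ 2 - A - x - x'; pose X' := l' ^+ 2 - A - x - x'.
rewrite (@add_distinct x y x' y' l X) //.
rewrite /neg (@add_distinct x y x' (- y') l' X') //.
have four : 4%:R != 0 :> K.
  by rewrite (_ : 4%:R = 2%:R * 2%:R) ?mulf_neq0 // -natrM.
have XX : X != X'.
  rewrite -subr_eq0 (_ : X - X' = - (4%:R * y * y' / d ^+ 2)).
    by rewrite oppr_eq0 !mulf_neq0 ?invr_eq0 ?expf_neq0.
  by rewrite /X /X' /l /l'; field.
rewrite (add_distinct XX erefl erefl) add_double //=.
set m := _ / (X' - X); set t := _ / _.
have [] := @add_add_sub_identity y d y' a (dcubic x) t l l' (X - x) (X' - x) m => //.
- rewrite h h' /cubic /a /dcubic /d; field; exact: d0.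
- by rewrite /X /a /d; ring.
- by rewrite /X' /a /d; ring.
- by rewrite /m; congr (_ / _); ring.
move=> e1 e2.
have {}e1 : m ^+ 2 - A - X - X' = t ^+ 2 - A - x - x.
  transitivity (m ^+ 2 - a - (X - x) - (X' - x) + x); first by rewrite /a; ring.
  by rewrite e1 /a; ring.
rewrite e1; congr (Some (_, _)).
transitivity (- (m * (t ^+ 2 - a - (X - x)) - (l * (X - x) + y))).
  by rewrite /a; ring.
by rewrite e2 /a; ring.
Qed.

(** With R = P + Q one has P = R - Q, and the claim becomes [add_add_sub] for R and Q. *)
Lemma addA_double P Q : on_cubic P -> on_cubic Q ->
  P <> None -> add (add P Q) (add P Q) = add P (add Q (add P Q)).
Proof.
move=> hP hQ nP; set R := add P Q; have hR : on_cubic R by exact: on_add.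
have eP : add R (neg Q) = P by exact: addpK.
have [eR|nR] := eqVneq R (neg Q).
  by rewrite eR addpN addp0 -[RHS]eP eR.
rewrite [RHS]addC // ?on_add // [add Q R]addC // -{1}eP add_add_sub //.
apply: abscissa_neq => // [eR|]; last by move/eqP: nR.
by apply: nP; rewrite -eP eR addpN.
Qed.

(** Zero points and opposite points are handled by [addpK], and the case where an end point is the
    sum of the other two by [addA_double]. In what remains the abscissas are distinct, except
    possibly those of two neighbours that are equal. *)
Lemma addA P Q S : on_cubic P -> on_cubic Q -> on_cubic S ->
  add (add P Q) S = add P (add Q S).
Proof.
(* By commutativity, associativity for a triple is equivalent to associativity for the reversed
   triple. *)
have mirror P' Q' S' : on_cubic P' -> on_cubic Q' -> on_cubic S' ->
    add (add S' Q') P' = add S' (add Q' P') ->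
    add (add P' Q') S' = add P' (add Q' S').
  move=> h1 h2 h3 e; rewrite [LHS]addC ?on_add // [add P' Q']addC // -e.
  by rewrite addC ?on_add // [add S' Q']addC.
have opp_sum P' Q' S' : on_cubic P' -> on_cubic Q' -> on_cubic S' ->
    S' = neg (add P' Q') -> add (add P' Q') S' = add P' (add Q' S').
  move=> h1 h2 h3 ->; rewrite addpN negD [add Q' _]addC ?on_add ?on_neg //.
  by rewrite -{2}[Q']negK addpK ?on_neg // addpN.
move=> hP hQ hS.
have [->|/eqP nP] := eqVneq P None; first by [].
have [->|/eqP nQ] := eqVneq Q None; first by rewrite addp0.
have [->|/eqP nS] := eqVneq S None; first by rewrite !addp0.
have [->|/eqP nPQ] := eqVneq P (neg Q).
  by apply: mirror; rewrite ?on_neg // addpK // addpN addp0.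
have [->|/eqP nQS] := eqVneq S (neg Q).
  by rewrite addpK // addpN addp0.
have [/opp_sum->//|/eqP nPQS] := eqVneq S (neg (add P Q)).
have [e|/eqP nQSP] := eqVneq P (neg (add Q S)).
  by apply: mirror => //; apply: opp_sum => //; rewrite e addC.
have [->|/eqP nPS] := eqVneq P S.
  by apply: mirror => //; rewrite addC ?on_add // [add Q S]addC.
have [->|/eqP nPS'] := eqVneq P (neg S).
  rewrite [add _ Q]addC ?on_neg // [RHS]addC ?on_neg ?on_add // addpK //.
  by rewrite -{2}[S]negK addpK ?on_neg.
have aPS : abscissa P <> abscissa S by exact: abscissa_neq.
have [e|/eqP nS'] := eqVneq S (add P Q); first by rewrite e addA_double.
have [e|/eqP nP'] := eqVneq P (add Q S).
  by apply: mirror => //; rewrite e [add Q S]addC // addA_double.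
have aPQS : abscissa (add P Q) <> abscissa S.
  apply: abscissa_neq; rewrite ?on_add //; first by move/esym.
  by move=> e; apply: nPQS; rewrite e negK.
have aQSP : abscissa P <> abscissa (add Q S).
  by apply: abscissa_neq; rewrite ?on_add.
have [e|/eqP nQS'] := eqVneq Q S; last first.
  apply: addA_generic => //; apply: abscissa_neq => // e.
  by apply: nQS; rewrite e negK.
(* When Q = S the tangent is moved to the first sum, where [addA_generic] admits it. *)
apply: (mirror) => //; apply: addA_generic => //.
- by move=> /esym.
- by rewrite e => /esym.
- by rewrite [add S Q]addC // => /esym.
- by rewrite [add Q P]addC // => /esym.
Qed.

End ShortCurve.

(** * Multiples, and valuation rings in which 2 is not a unit *)

Section Multiples.
Variables (K : fieldType) (A B C : K).
Hypothesis two_neq0 : 2%:R != 0 :> K.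
Hypothesis smooth : forall e, cubic A B C e = 0 -> dcubic A B e != 0.
Local Notation add := (add A B).
Local Notation on_cubic := (on_cubic A B C).

Definition mul n (P : option (K * K)) := iter n (add P) None.

Lemma on_mul n P : on_cubic P -> on_cubic (mul n P).
Proof. by move=> hP; elim: n => [|n IH] //=; apply: on_add. Qed.

Lemma mulD m n P : on_cubic P -> mul (m + n) P = add (mul m P) (mul n P).
Proof.
by move=> hP; elim: m => [|m IH] //=; rewrite IH (addA (C := C)) ?on_mul.
Qed.

Lemma mul_modn N n P : on_cubic P -> mul N P = None -> mul n P = mul (n %% N) P.
Proof.
move=> hP e; rewrite {1}(divn_eq n N) mulD //.
suff -> : mul (n %/ N * N) P = None by [].
by elim: (n %/ N)%N => [|q IH] //; rewrite mulSn mulD // e IH.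
Qed.

(** Pigeonhole: the N + 1 exponents 2^0, ..., 2^N cannot be distinct modulo N. *)
Lemma torsion_powers2 N P : on_cubic P -> (0 < N)%N -> mul N P = None ->
  exists i j, (i < j)%N /\ mul (2 ^ i) P = mul (2 ^ j) P.
Proof.
move=> hP N0 e; apply: contrapT => h.
pose g (i : 'I_N.+1) : 'I_N := Ordinal (ltn_pmod (2 ^ i) N0).
have : injective g.
  move=> i j /(congr1 val) /= eij; apply: val_inj; apply: contrapT => ne.
  have e2 : mul (2 ^ i) P = mul (2 ^ j) P.
    by rewrite (mul_modn _ hP e) eij -(mul_modn _ hP e).
  by case: (ltngtP i j) => // lt; apply: h; [exists i, j | exists j, i].
by move/leq_card; rewrite !card_ord ltnn.
Qed.

End Multiples.

(** * Subrings maximal among those without one half are valuation rings *)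

Section MaximalSubring.
Variable K : fieldType.
Implicit Types O : set K.

Definition subring O :=
  [/\ O 1, forall x y, O x -> O y -> O (x - y)
    & forall x y, O x -> O y -> O (x * y)].

Section Subring.
Variable O : set K.
Hypothesis ringO : subring O.

Lemma subring1 : O 1. Proof. by case: ringO. Qed.
Lemma subringB x y : O x -> O y -> O (x - y).
Proof. by case: ringO => _ + _; apply. Qed.
Lemma subringM x y : O x -> O y -> O (x * y).
Proof. by case: ringO => _ _; apply. Qed.
Lemma subring0 : O 0.
Proof. by rewrite -(subrr 1); apply: subringB; apply: subring1. Qed.
Lemma subringN x : O x -> O (- x).
Proof. by rewrite -sub0r; apply: subringB; apply: subring0. Qed.
Lemma subringD x y : O x -> O y -> O (x + y).
Proof. by move=> hx hy; rewrite -[y]opprK; apply/subringB/subringN. Qed.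
Lemma subringX x n : O x -> O (x ^+ n).
Proof.
move=> hx; elim: n => [|n IH]; first by rewrite expr0; apply: subring1.
by rewrite exprS; apply: subringM.
Qed.
Lemma subring_nat n : O n%:R.
Proof.
elim: n => [|n IH]; first exact: subring0.
by rewrite -addn1 natrD; apply: subringD => //; apply: subring1.
Qed.
Lemma subring_sum (I : Type) (r : seq I) (P : pred I) (F : I -> K) :
  (forall i, P i -> O (F i)) -> O (\sum_(i <- r | P i) F i).
Proof.
move=> h; apply: (big_ind O) => //; first exact: subring0.
exact: subringD.
Qed.
End Subring.

Definition over O (q : {poly K}) := forall i, O q`_i.

Lemma over_subring O t : subring O -> subring [set q.[t] | q in over O].
Proof.
move=> rO; split=> [|_ _ [q hq <-] [r hr <-]|_ _ [q hq <-] [r hr <-]].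
- exists 1 => [i|]; last by rewrite hornerE.
  by rewrite coef1; apply: subring_nat.
- exists (q - r) => [i|]; last by rewrite !hornerE.
  by rewrite coefB; apply: subringB.
- exists (q * r) => [i|]; last by rewrite !hornerE.
  by rewrite coefM; apply: subring_sum => // j _; apply: subringM.
Qed.

Lemma over_base O t : subring O -> O `<=` [set q.[t] | q in over O].
Proof.
move=> rO x hx; exists x%:P; last by rewrite hornerC.
by move=> i; rewrite coefC; case: ifP => // _; apply: subring0.
Qed.

Lemma over_gen O t : subring O -> [set q.[t] | q in over O] t.
Proof.
move=> rO; exists 'X; last by rewrite hornerX.
by move=> i; rewrite coefX; apply: subring_nat.
Qed.

(** Chevalley's construction of a valuation ring whose maximal ideal contains 2. *)
Definition maximal_without_half O :=
  [/\ subring O, ~ O 2%:R^-1 &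
      forall O', subring O' -> O `<=` O' -> ~ O' 2%:R^-1 -> O' `<=` O].

Lemma exists_maximal_without_half : [pchar K] =i pred0 ->
  exists O, maximal_without_half O.
Proof.
move=> char0.
(* Containing 1 is demanded of inhabited sets only, because the union of the empty chain is empty
   and must still be good. *)
pose good X := [/\ forall x : K, X x -> X 1,
  forall x y, X x -> X y -> X (x - y), forall x y, X x -> X y -> X (x * y)
  & ~ X 2%:R^-1].
have [F Fgood tF|O [[h1 hB hM hN] maxO]] := @Zorn_bigcup K good.
  have pair x y X Y : F X -> X x -> F Y -> Y y -> exists Z, [/\ F Z, Z x & Z y].
    move=> FX Xx FY Yy; case: (tF X Y FX FY) => s.
      by exists Y; split=> //; apply: s.
    by exists X; split=> //; apply: s.
  split.
  - by move=> x [X FX Xx]; exists X => //; case: (Fgood _ FX) => h _ _ _;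
      apply: h Xx.
  - move=> x y [X FX Xx] [Y FY Yy]; have [Z [FZ Zx Zy]] := pair _ _ _ _ FX Xx FY Yy.
    by exists Z => //; case: (Fgood _ FZ) => _ h _ _; apply: h.
  - move=> x y [X FX Xx] [Y FY Yy]; have [Z [FZ Zx Zy]] := pair _ _ _ _ FX Xx FY Yy.
    by exists Z => //; case: (Fgood _ FZ) => _ _ h _; apply: h.
  - by move=> [X FX X2]; case: (Fgood _ FX) => _ _ _; apply.
have good_sub X : subring X -> ~ X 2%:R^-1 -> good X by case=> h hb hm; split.
exists O.
suff O1 : O 1.
  split=> // O' rO' sO nO'; apply: contrapT => ns.
  by apply: (maxO O'); [split | apply: good_sub].
apply: contrapT => nO1.
have eO x : ~ O x by move=> /h1.
(* A maximal set without 1 would be empty, but the image of the integers is a larger good set: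
   parity keeps one half out of it. *)
pose Z := [set x : K | exists a b : nat, x = a%:R - b%:R].
have nat0 (n : nat) : (n%:R == 0 :> K) = (n == 0%N) by move/pcharf0P: char0 => ->.
apply: (maxO Z).
  by split=> [x /eO //|/(_ 0)]; apply/not_implyP; split; [exists 0%N, 0%N;
    rewrite subr0 | exact: eO].
apply: good_sub.
  split.
  - by exists 1%N, 0%N; rewrite subr0.
  - by move=> _ _ [a [b ->]] [c [d ->]]; exists (a + d)%N, (b + c)%N;
      rewrite !natrD; ring.
  - move=> _ _ [a [b ->]] [c [d ->]]; exists (a * c + b * d)%N, (a * d + b * c)%N.
    by rewrite !natrD !natrM; ring.
move=> [a [b e]].
have two0 : 2%:R != 0 :> K by rewrite nat0.
have : (2 * a)%:R = (2 * b + 1)%:R :> K.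
  rewrite natrD !natrM -(subrK b%:R a%:R) -e; field; exact: two0.
move/eqP; rewrite -subr_eq0; case: (leqP (2 * b + 1) (2 * a)) => h.
  rewrite -natrB // nat0 subn_eq0 => h'.
  have : (2 * a)%N == (2 * b + 1)%N by rewrite eqn_leq h h'.
  by move/eqP/(congr1 odd); rewrite oddD !oddM.
by rewrite -oppr_eq0 opprB -natrB ?(ltnW h) // nat0 subn_eq0 leqNgt h.
Qed.

Section Valuation.
Variable O : set K.
Hypothesis maxO : maximal_without_half O.
Hypothesis two_neq0 : 2%:R != 0 :> K.

Let rO : subring O. Proof. by case: maxO. Qed.
Let nO : ~ O 2%:R^-1. Proof. by case: maxO. Qed.

(** Maximality applied to the ring O[t], which is strictly larger than O. *)
Lemma half_over t : ~ O t -> exists2 q, over O q & 2%:R * q.[t] = 1.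
Proof.
move=> nt; apply: contrapT => h; apply: nt.
case: maxO => _ _ /(_ [set q.[t] | q in over O]); apply.
- exact: over_subring.
- exact: over_base.
- by move=> [q hq e]; apply: h; exists q => //; rewrite e mulfV.
- exact: over_gen.
Qed.

Lemma half_neq1 r : O r -> 2%:R * r <> 1.
Proof.
move=> hr e; apply: nO; rewrite (_ : 2%:R^-1 = r) //.
by apply: (mulfI two_neq0); rewrite e mulfV.
Qed.

(** If the inverse of v = 1 + 2 r were not in O, then one half would be a polynomial in 1 / v.
    Multiplied by a power of v, which is again 1 modulo 2 O, this relation puts one half into O. *)
Lemma one_add_double_unit r : O r ->
  1 + 2%:R * r != 0 /\ O (1 + 2%:R * r)^-1.
Proof.
move=> hr; set v := 1 + _.
have v0 : v != 0.
  apply/eqP => e; apply: (half_neq1 (subringN rO hr)).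
  by rewrite mulrN; apply/eqP; rewrite -subr_eq0 -opprD addrC oppr_eq0 -/v e.
split=> //; apply: contrapT => /half_over [q hq e].
have hv : O v by apply: subringD => //; [exact: subring1|apply: subringM => //;
  exact: subring_nat].
have [r' hr' er'] : exists2 r', O r' & v ^+ size q = 1 + 2%:R * r'.
  elim: (size q) => [|n [s hs es]].
    by exists 0; [exact: subring0 | rewrite mulr0 addr0].
  exists (s + r * v ^+ n); last by rewrite exprS {1}/v mulrDl mul1r {1}es; ring.
  by apply: subringD => //; apply: subringM => //; apply: subringX.
have [s hs es] : exists2 s, O s & v ^+ size q * q.[v^-1] = s.
  exists (\sum_(i < size q) q`_i * v ^+ (size q - i)).
    by apply: subring_sum => // i _; apply: subringM => //; apply: subringX.
  rewrite horner_coef mulr_sumr; apply: eq_bigr => i _.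
  by rewrite mulrCA exprVn -expfB // ?(ltnW (ltn_ord i)).
apply: (@half_neq1 (s - r')); first exact: subringB.
by rewrite mulrBr -es mulrCA e mulr1 er' addrK.
Qed.

Lemma degree_drop t q s : t != 0 -> over O q -> over O s ->
  2%:R * q.[t] = 1 -> 2%:R * s.[t^-1] = 1 -> (size s <= size q)%N ->
  exists q', [/\ over O q', 2%:R * q'.[t] = 1 & (size q' < size q)%N].
Proof.
move=> t0 hq hs eq es le.
have q0 : (0 < size q)%N.
  rewrite lt0n size_poly_eq0; apply/eqP => q0.
  by move: eq; rewrite q0 horner0 mulr0 => /esym/eqP; rewrite oner_eq0.
have s0 : (0 < size s)%N.
  rewrite lt0n size_poly_eq0; apply/eqP => s0.
  by move: es; rewrite s0 horner0 mulr0 => /esym/eqP; rewrite oner_eq0.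
pose n := (size q).-1; have en : size q = n.+1 by rewrite prednK.
pose m := (size s).-1; have em : size s = m.+1 by rewrite prednK.
have [v0 hv] := one_add_double_unit (subringN rO (hs 0%N)).
set v := 1 + _ in v0 hv.
(* Multiplying 2 s(1 / t) = 1 by t^n and dividing by the unit v = 1 - 2 s_0 expresses t^n by lower
   powers of t; this replaces the leading term of [q]. *)
pose S := \sum_(j < m) s`_j.+1 *: 'X^(n - j.+1).
have lemn : (m <= n)%N by rewrite -ltnS -em -en.
have eS : 2%:R * (v^-1 * S.[t]) = t ^+ n.
  have -> : S.[t] = t ^+ n * \sum_(j < m) s`_j.+1 * t^-1 ^+ j.+1.
    rewrite /S horner_sum mulr_sumr; apply: eq_bigr => j _.
    rewrite hornerZ hornerXn mulrCA; congr (_ * _).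
    by rewrite exprVn expfB_cond // (negPf t0) (leq_trans (ltn_ord j)).
  have -> : \sum_(j < m) s`_j.+1 * t^-1 ^+ j.+1 = v / 2%:R.
    move: es; rewrite horner_coef em big_ord_recl expr0 mulr1 => es.
    apply: (mulfI two_neq0); rewrite [2%:R * (v / _)]mulrC divfK // /v mulrN.
    by rewrite -[X in _ = X - _]es mulrDr addrAC subrr add0r.
  by clearbody v; field; rewrite two_neq0 v0.
exists (\poly_(i < n) q`_i + (2%:R * q`_n * v^-1) *: S); split.
- move=> i; rewrite coefD coefZ coef_poly; apply: subringD => //.
    by case: ifP => // _; exact: subring0.
  apply: subringM => //.
    apply: subringM => //; apply: subringM => //; exact: subring_nat.
  rewrite coef_sum; apply: subring_sum => // j _; rewrite coefZ coefXn.
  by apply: subringM => //; exact: subring_nat.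
- rewrite !hornerE horner_poly -[RHS]eq [in RHS]horner_coef en big_ord_recr /=.
  by rewrite -eS; congr (_ * (_ + _)); ring.
- rewrite en ltnS; apply: leq_trans (size_polyD _ _) _.
  rewrite geq_max size_poly /=; apply: leq_trans (size_scale_leq _ _) _.
  apply: leq_trans (size_sum _ _ _) _; apply/bigmax_leqP => j _.
  apply: leq_trans (size_scale_leq _ _) _; rewrite size_polyXn.
  by rewrite -subSn ?subSS ?leq_subr // (leq_trans (ltn_ord j)).
Qed.

(** If both fail, one half is a polynomial in t and also one in 1 / t. [degree_drop] shortens the
    longer of the two, and exchanging t with 1 / t makes the descent symmetric and endless. *)
Lemma valuation_ring t : O t \/ O t^-1.
Proof.
apply: contrapT => /not_orP [nt nt'].
have t0 : t != 0 by apply/eqP => e; apply: nt; rewrite e; apply: subring0.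
have [q hq eq] := half_over nt; have [s hs es] := half_over nt'.
have [N] := ubnP (size q + size s).
elim: N t q s t0 {nt nt'} hq hs eq es => // N IH t q s t0 hq hs eq es.
rewrite ltnS => le.
case: (leqP (size s) (size q)) => [c|/ltnW c].
  have [q' [hq' eq' lt]] := degree_drop t0 hq hs eq es c.
  by apply: (IH t q' s) => //; apply: leq_trans le; rewrite ltn_add2r.
have t0' : t^-1 != 0 by rewrite invr_eq0.
have eq2 : 2%:R * q.[t^-1^-1] = 1 by rewrite invrK.
have [s' [hs' es' lt]] := degree_drop t0' hs hq es eq2 c.
by apply: (IH t q s') => //; apply: leq_trans le; rewrite ltn_add2l.
Qed.

End Valuation.
End MaximalSubring.

(** * Points near infinity are not torsion *)

Section NonTorsion.
Variables (K : fieldType) (A B C : K) (O : set K).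
Hypothesis two_neq0 : 2%:R != 0 :> K.
Hypothesis smooth : forall e, cubic A B C e = 0 -> dcubic A B e != 0.
Hypothesis maxO : maximal_without_half O.
Variable u : K.
Hypotheses (u0 : u != 0) (hu : O u).
Hypotheses (huA : O (u * A)) (huB : O (u * B)) (huC : O (u * C)).

Let rO : subring O. Proof. by case: maxO. Qed.

(** For w = 1 / x the duplication formula reads 1 / x(2P) = 4 w alpha / beta, where [alpha] and
    [beta] are 1 modulo 2 O and therefore units. *)
Lemma double_near_infinity i x y e : O e -> O e^-1 -> e != 0 ->
  x^-1 = 4%:R ^+ i.+1 * u * e -> y ^+ 2 = cubic A B C x ->
  exists x' y' e', [/\ O e', O e'^-1, e' != 0,
    add A B (Some (x, y)) (Some (x, y)) = Some (x', y') &
    x'^-1 = 4%:R ^+ i.+2 * u * e'].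
Proof.
move=> he he' e0 ew hy; have four0 : 4%:R != 0 :> K.
  by rewrite (_ : 4%:R = 2%:R * 2%:R) ?mulf_neq0 // -natrM.
set w := x^-1 in ew.
have w0 : w != 0 by rewrite ew !mulf_neq0 ?expf_neq0.
have x0 : x != 0 by rewrite -invr_eq0.
have ex : x = w^-1 by rewrite invrK.
(* Chosen so that w = 2 v u; then A w, B w and C w lie in 2 O. *)
pose v := 2%:R * 4%:R ^+ i * e.
have hv : O v by do ![apply: subringM => //| apply: subringX => //
  |exact: subring_nat].
have hw0 : w = 2%:R * (v * u) by rewrite ew /v exprS; ring.
pose w1 := v * u; have h1 : O w1 by exact: subringM.
pose a := v * (u * A); have ha : O a by exact: subringM.
pose b := v * (u * B); have hb : O b by exact: subringM.
pose c := v * (u * C); have hc : O c by exact: subringM.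
have eA : A * w = 2%:R * a by rewrite hw0 /a; ring.
have eB : B * w = 2%:R * b by rewrite hw0 /b; ring.
have eC : C * w = 2%:R * c by rewrite hw0 /c; ring.
pose alpha := 1 + 2%:R * (a + b * (2%:R * w1) + c * (2%:R * w1) ^+ 2).
pose beta := 1 + 2%:R * (- (2%:R * b * (2%:R * w1)) - 8%:R * c * (2%:R * w1) ^+ 2
  + (2%:R * b ^+ 2 - 8%:R * a * c) * (2%:R * w1) ^+ 2).
have hn n : O n%:R by exact: subring_nat.
have [al0 hal] : alpha != 0 /\ O alpha^-1.
  apply: one_add_double_unit => //.
  by do ![apply: subringD => //|apply: subringM => //|apply: subringX => //].
have [be0 hbe] : beta != 0 /\ O beta^-1.
  apply: one_add_double_unit => //.
  by do ![apply: subringB => //|apply: subringN => //|apply: subringD => //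
         |apply: subringM => //|apply: subringX => //].
have hal' : O alpha.
  rewrite /alpha; by do ![apply: subringD => //|apply: subringM => //
    |apply: subringX => //|exact: subring1].
have hbe' : O beta.
  rewrite /beta; by do ![exact: subring1|apply: subringB => //|apply: subringN => //
    |apply: subringD => //|apply: subringM => //|apply: subringX => //].
have eal : alpha = 1 + A * w + B * w * w + C * w * w ^+ 2.
  by rewrite eA eB eC hw0 /alpha /w1; ring.
have ebe : beta = 1 - 2%:R * (B * w) * w - 8%:R * (C * w) * w ^+ 2
    + ((B * w) ^+ 2 - 4%:R * (A * w) * (C * w)) * w ^+ 2.
  by rewrite eA eB eC hw0 /beta /w1; ring.
have ecub : cubic A B C x = alpha / w ^+ 3.
  by rewrite ex eal /cubic; field.
have y0 : y != 0.
  by rewrite -sqrf_eq0 hy ecub mulf_neq0 ?invr_eq0 ?expf_neq0.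
rewrite (add_double _ _ two_neq0) //=; set t := _ / _.
have ex' : t ^+ 2 - A - x - x = beta / (4%:R * alpha * w).
  have -> : t ^+ 2 = dcubic A B x ^+ 2 / (4%:R * (alpha / w ^+ 3)).
    by rewrite -ecub -hy /t; field; rewrite four0 two_neq0 y0.
  rewrite ebe ex; move: al0; rewrite eal /dcubic => al0.
  by field; rewrite four0 w0 /= ?al0.
exists (t ^+ 2 - A - x - x); eexists; exists (e * alpha / beta); split.
- by do ![apply: subringM => //].
- by rewrite !invfM invrK; do ![apply: subringM => //].
- by rewrite !mulf_neq0 ?invr_eq0.
- by [].
- rewrite ex' ew !exprS; clearbody alpha beta; field.
  by rewrite be0 al0 u0 e0 four0 expf_neq0.
Qed.

Lemma near_infinity_not_torsion y N :
  y ^+ 2 = cubic A B C (4%:R * u)^-1 -> (0 < N)%N ->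
  mul A B N (Some ((4%:R * u)^-1, y)) <> None.
Proof.
move=> hy N0 e; set P := Some _ in e.
have hP : on_cubic A B C P by apply/eqP.
have four0 : 4%:R != 0 :> K.
  by rewrite (_ : 4%:R = 2%:R * 2%:R) ?mulf_neq0 // -natrM.
have H i : exists x' y' e', [/\ O e', O e'^-1, e' != 0,
    mul A B (2 ^ i) P = Some (x', y') & x'^-1 = 4%:R ^+ i.+1 * u * e'].
  elim: i => [|i [x1 [y1 [e1 [h1 h2 h3 h4 h5]]]]].
    exists (4%:R * u)^-1, y, 1; rewrite invr1 invrK mulr1 expr1 oner_eq0.
    by split=> //; apply: subring1.
  have : on_cubic A B C (Some (x1, y1)) by rewrite -h4; apply: on_mul.
  move=> /eqP /(double_near_infinity h1 h2 h3 h5) [x2 [y2 [e2 [k1 k2 k3 k4 k5]]]].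
  exists x2, y2, e2; split=> //.
  by rewrite expnS mul2n -addnn (mulD (C := C)) // h4.
have [i [j [lt eij]]] := torsion_powers2 two_neq0 smooth hP N0 e.
have [x1 [y1 [e1 [h1 h2 h3 h4 h5]]]] := H i.
have [x2 [y2 [e2 [k1 k2 k3 k4 k5]]]] := H j.
have ex : x1 = x2 by move: eij; rewrite h4 k4 => -[].
have ej : j = (i + (j - i.+1).+1)%N by rewrite addnS -addSn subnKC.
move: k5; rewrite -ex h5 ej -addSn exprD [4%:R ^+ (_ - _).+1]exprS.
move: (j - i.+1)%N => d ee.
(* Comparing the two expressions gives e1 = 4^(d + 1) e2; dividing by the unit [e1] would put one
   half into O. *)
apply: (half_neq1 maxO two_neq0 (r := 2%:R * 4%:R ^+ d * e2 / e1)).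
  by do ![apply: subringM => //|apply: subringX => //|exact: subring_nat].
have cancel : e1 = 4%:R * 4%:R ^+ d * e2.
  apply: (mulfI (mulf_neq0 (expf_neq0 i.+1 four0) u0)).
  by rewrite ee; ring.
rewrite {1}cancel; field; rewrite four0 expf_neq0 //=.
by move: h3; rewrite cancel !mulf_eq0 !negb_or => /andP[_ ->].
Qed.

End NonTorsion.

(** As O is a valuation ring, an entry outside O has its inverse in O; [c] is the product of these
    inverses. *)
Lemma common_scaling (k K : fieldType) (iota : {rmorphism k -> K}) (O : set K)
    (l : seq k) : maximal_without_half O -> 2%:R != 0 :> K ->
  exists c : k, [/\ c != 0, O (iota c) &
                    {in l, forall a, O (iota c * iota a)}].
Proof.
move=> maxO two0; have rO : subring O by case: maxO.
elim: l => [|a l [c [c0 hc hl]]].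
  by exists 1; rewrite oner_eq0 rmorph1; split=> //; apply: subring1.
have [d [d0 hd hda]] : exists d, [/\ d != 0, O (iota d) & O (iota d * iota a)].
  case: (pselect (O (iota a))) => ha.
    exists 1; rewrite oner_eq0 rmorph1 mul1r; split=> //; exact: subring1.
  have a0 : a != 0 by apply/eqP => a0; apply: ha; rewrite a0 rmorph0;
    apply: subring0.
  exists a^-1; rewrite invr_eq0 fmorphV mulVf ?fmorph_eq0 //; split=> //.
    by case: (valuation_ring maxO two0 (iota a)).
  exact: subring1.
exists (d * c); rewrite mulf_neq0 // rmorphM; split=> //; first exact: subringM.
move=> b; rewrite inE => /orP [/eqP ->|/hl hb].
  by rewrite mulrAC; apply: subringM.
by rewrite -mulrA; apply: subringM.
Qed.

(** * Places at which an integer is not a square up to units *)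

Section SubfieldType.
Variables (L : fieldType) (P : L -> Prop).
Hypotheses (P1 : P 1) (PB : forall x y, P x -> P y -> P (x - y)).
Hypothesis (PV : forall x y, P x -> P y -> P (x / y)).

Definition subfield_pred : {pred L} := fun x => `[< P x >].

Fact subfield_pred_closed : divring_closed subfield_pred.
Proof.
split=> [|x y|x y]; rewrite ?unfold_in; first exact/asboolP.
  by move=> /asboolP hx /asboolP hy; apply/asboolP; apply: PB.
by move=> /asboolP hx /asboolP hy; apply/asboolP; apply: PV.
Qed.

HB.instance Definition _ :=
  GRing.isDivringClosed.Build L subfield_pred subfield_pred_closed.

Record subfield_type := SubfieldType {
  subfield_val : L; _ : subfield_val \in subfield_pred }.
HB.instance Definition _ := [isSub for subfield_val].
HB.instance Definition _ := [Choice of subfield_type by <:].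
HB.instance Definition _ := [SubChoice_isSubIntegralDomain of subfield_type by <:].
HB.instance Definition _ := [SubIntegralDomain_isSubField of subfield_type by <:].

Lemma exists_subfield : exists (F : fieldType) (f : {rmorphism F -> L}),
  forall y, P y <-> exists x, y = f x.
Proof.
exists subfield_type, (\val : subfield_type -> L) => y; split.
  by move=> /asboolP hy; exists (@SubfieldType y hy).
by move=> [[x hx] ->]; apply/asboolP.
Qed.
End SubfieldType.

Lemma seq_choice (T U : eqType) (Q : T -> U -> Prop) (l : seq T) :
  {in l, forall y, exists a, Q y a} ->
  exists m : seq U, {in l, forall y, exists2 a, a \in m & Q y a}.
Proof.
elim: l => [|y l IH] h; first by exists [::].
have [a ha] := h y (mem_head _ _).
have [|m hm] := IH; first by move=> z hz; apply: h; rewrite inE hz orbT.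
exists (a :: m) => z; rewrite inE => /orP [/eqP ->|/hm [b hb q]].
  by exists a; rewrite ?mem_head.
by exists b; rewrite // inE hb orbT.
Qed.

Section Places.
Variables (F kappa : fieldType).

(* [R x r] says that the place sends [x] to [r]; elements at which the place
   is infinite have no image. *)
Definition is_place (R : F -> kappa -> Prop) :=
  [/\ R 1 1,
      forall x r y s, R x r -> R y s -> R (x - y) (r - s),
      forall x r y s, R x r -> R y s -> R (x * y) (r * s),
      forall r, R 0 r -> r = 0 &
      forall x, x != 0 -> (exists r, R x r) \/ R x^-1 0].

(* The last clause says that [p] is not the product of a square and a unit of
   the valuation ring. *)
Definition odd_at (R : F -> kappa -> Prop) (p : nat) :=
  [/\ (0 < p)%N, R p%:R 0 & forall g r, R (g ^+ 2 / p%:R) r -> r = 0].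

Definition finite_at (R : F -> kappa -> Prop) x := exists r, R x r.
End Places.

(** The list is there so that, in an extension of F, the polynomials over F that describe finitely
    many elements can all be reduced at the place. *)
Definition has_odd_places (F : fieldType) := forall l : seq F,
  exists (kappa : fieldType) (R : F -> kappa -> Prop) (p : nat),
    [/\ is_place R, odd_at R p & {in l, forall x, finite_at R x}].

(** * The prime field and its reductions modulo primes *)

Section RationalBase.
Variables (L : fieldType) (char0 : [pchar L] =i pred0).

Lemma intr_eq0_char0 (a : int) : (a%:~R == 0 :> L) = (a == 0).
Proof.
have /pcharf0P h := char0; case: a => n; first by rewrite -pmulrn h.
by rewrite NegzE mulrNz oppr_eq0 -pmulrn h.
Qed.

Lemma intr_eq0_Fp p (a : int) : prime p ->
  (a%:~R == 0 :> 'F_p) = (p %| `|a|)%N.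
Proof.
move=> pp; have h n : (n%:R == 0 :> 'F_p) = (p %| n)%N.
  by rewrite (dvdn_pcharf (pchar_Fp pp)).
by case: a => n; rewrite ?NegzE ?mulrNz ?oppr_eq0 -pmulrn h ?abszN.
Qed.

Definition quotient_of_ints (y : L) :=
  exists a b : int, b != 0 /\ y = a%:~R / b%:~R.

Lemma quotient_of_ints_field : exists (F : fieldType) (f : {rmorphism F -> L}),
  forall y, quotient_of_ints y <-> exists x, y = f x.
Proof.
apply: exists_subfield => [|_ _ [a [b [b0 ->]]] [c [d [d0 ->]]]|
  _ _ [a [b [b0 ->]]] [c [d [d0 ->]]]].
- by exists 1, 1; rewrite divr1.
- exists (a * d - c * b), (b * d); rewrite mulf_neq0 //; split=> //.
  by rewrite rmorphB !rmorphM /=; field; rewrite !intr_eq0_char0 b0 d0.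
- have [->|c0] := eqVneq c 0; first by exists 0, 1; rewrite !mul0r invr0 mulr0.
  exists (a * d), (b * c); rewrite mulf_neq0 //; split=> //.
  by rewrite !rmorphM /=; field; rewrite !intr_eq0_char0 b0 c0 d0.
Qed.

Section PrimePlace.
Variables (F : fieldType) (f : {rmorphism F -> L}).
Hypothesis fP : forall y, quotient_of_ints y <-> exists x, y = f x.
Variables (p : nat) (pp : prime p).

Definition reduction (x : F) (r : 'F_p) := exists a b : int,
  [/\ b%:~R != 0 :> 'F_p, f x = a%:~R / b%:~R & r = a%:~R / b%:~R].

Lemma den_neq0 (b : int) : b%:~R != 0 :> 'F_p -> b%:~R != 0 :> L.
Proof.
by rewrite intr_eq0_char0; apply: contraNneq => ->; rewrite rmorph0.
Qed.

Lemma reduction_place : is_place reduction.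
Proof.
split.
- by exists 1, 1; rewrite rmorph1 !divr1 oner_eq0.
- move=> x r y s [a [b [b0 ex ->]]] [c [d [d0 ey ->]]].
  exists (a * d - c * b), (b * d); rewrite intrM mulf_neq0 //.
  rewrite !rmorphB !rmorphM /= ex ey; split=> //; field; apply/andP => //.
  by split; apply: den_neq0.
- move=> x r y s [a [b [b0 ex ->]]] [c [d [d0 ey ->]]].
  exists (a * c), (b * d); rewrite intrM mulf_neq0 //.
  by rewrite !rmorphM /= ex ey; split=> //; rewrite mulf_div.
- move=> r [a [b [b0 e ->]]]; move/eqP: e.
  rewrite rmorph0 eq_sym mulf_eq0 invr_eq0 (negPf (den_neq0 b0)) orbF.
  by rewrite intr_eq0_char0 => /eqP ->; rewrite rmorph0 mul0r.
move=> x x0; have [] : quotient_of_ints (f x) by apply/fP; exists x.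
move=> a [b [b0 e]].
(* Lowest terms are taken from [rat], so that p cannot divide both numerator and denominator. *)
pose q := a%:~R / b%:~R : rat.
have {e} e : f x = (numq q)%:~R / (denq q)%:~R.
  rewrite e; apply/eqP; rewrite eqr_div ?intr_eq0_char0 ?denq_neq0 //.
  rewrite -!intrM; apply/eqP; congr (_%:~R).
  apply/eqP; rewrite -(eqr_int rat) !intrM -eqr_div ?intr_eq0 ?denq_neq0 //.
  by rewrite divq_num_den.
have [dq|dq] := eqVneq ((denq q)%:~R : 'F_p) 0; last first.
  by left; exists ((numq q)%:~R / (denq q)%:~R), (numq q), (denq q).
have nq : (numq q)%:~R != 0 :> 'F_p.
  rewrite intr_eq0_Fp //; apply/negP => h.
  move/eqP: dq; rewrite intr_eq0_Fp // => h'.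
  have := dvdn_gcd p `|numq q| `|denq q|; rewrite h h' /=.
  have := coprime_num_den q; rewrite /coprime => /eqP ->.
  by rewrite dvdn1 => /eqP p1; move: pp; rewrite p1.
right; exists (denq q), (numq q); split=> //; first by rewrite fmorphV e invf_div.
by rewrite dq mul0r.
Qed.

Lemma reduction_odd : odd_at reduction p.
Proof.
split; first exact: prime_gt0.
  exists p%:Z, 1; rewrite rmorph_nat !divr1 oner_eq0; split=> //.
  by rewrite -pmulrn pcharf0 ?pchar_Fp.
move=> g r [c [d [d0 e ->]]].
have [] : quotient_of_ints (f g) by apply/fP; exists g.
move=> a [b [b0 eg]].
have [c0|c0] := eqVneq (c%:~R : 'F_p) 0; first by rewrite c0 mul0r.
have d0' := den_neq0 d0; have b0' : b%:~R != 0 :> L by rewrite intr_eq0_char0.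
have p0' : p%:R != 0 :> L.
  by have /pcharf0P -> := char0; rewrite -lt0n prime_gt0.
(* With c and d prime to p, the exponent of p is even on the left and odd on the right. *)
have E : a ^+ 2 * d = p%:Z * b ^+ 2 * c.
  apply/eqP; rewrite -subr_eq0 -intr_eq0_char0 rmorphB subr_eq0 /=.
  rewrite !expr2 !intrM -pmulrn; apply/eqP.
  move: e; rewrite rmorphM fmorphV rmorph_nat rmorphXn /= eg => e.
  transitivity ((a%:~R / b%:~R) ^+ 2 / p%:R * (b%:~R ^+ 2 * p%:R * d%:~R) : L).
    by field; rewrite b0' p0'.
  by rewrite e; field.
have a0 : a != 0.
  apply: contraNneq c0 => a0; move/eqP: E; rewrite a0 expr0n mul0r eq_sym.
  have pz : p%:Z != 0 by rewrite -intr_eq0_char0 -pmulrn.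
  by rewrite mulf_eq0 (negPf (mulf_neq0 pz (expf_neq0 2 b0))) => /eqP ->.
move/(congr1 absz): E; rewrite !expr2 !abszM absz_nat => /(congr1 (logn p)).
have pos (z : int) : z != 0 -> (0 < `|z|)%N by rewrite absz_gt0.
have cop (z : int) : z%:~R != 0 :> 'F_p -> (0 < `|z|)%N /\ logn p `|z| = 0%N.
  move=> z0; split.
    by apply: pos; apply: contraNneq z0 => ->; rewrite rmorph0.
  rewrite lognE pp; case: ifP => // /= /andP [_ h].
  by move: z0; rewrite intr_eq0_Fp // h.
have [d1 d2] := cop _ d0; have [c1 c2] := cop _ c0.
have a1 := pos _ a0; have b1 := pos _ b0; have p1 := prime_gt0 pp.
rewrite !lognM ?muln_gt0 ?a1 ?b1 ?c1 ?d1 ?p1 // d2 c2 (logn_prime p pp).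
by rewrite eqxx !addn0 add1n !addnn => /(congr1 odd); rewrite oddS !odd_double.
Qed.
End PrimePlace.

Lemma rational_base : exists (F : fieldType) (f : {rmorphism F -> L}),
  has_odd_places F.
Proof.
have [F [f fP]] := quotient_of_ints_field; exists F, f => l.
have [|m hm] := @seq_choice F int
  (fun y b => b != 0 /\ exists a : int, f y = a%:~R / b%:~R) l.
  move=> y _; have [] : quotient_of_ints (f y) by apply/fP; exists y.
  by move=> a [b [b0 e]]; exists b; split=> //; exists a.
(* A prime above the sum of the denominators divides none of them. *)
have [p hp pp] := prime_above (\sum_(b <- m) `|b|)%N.
exists 'F_p, (reduction f (p := p)), p; split.
- exact: reduction_place.
- exact: (reduction_odd fP).
move=> y /hm [b hb [b0 [a e]]].
exists (a%:~R / b%:~R), a, b; split=> //.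
rewrite intr_eq0_Fp //; apply/negP => /dvdn_leq; rewrite absz_gt0 => /(_ b0).
rewrite leqNgt (leq_ltn_trans _ hp) // (big_rem b) //=; exact: leq_addr.
Qed.
End RationalBase.

(** * Extending places to transcendental extensions *)

Lemma nonroot_nat (F : fieldType) (q : {poly F}) : [pchar F] =i pred0 ->
  q != 0 -> exists m : nat, ~~ root q m%:R.
Proof.
move=> char0 q0; apply: contrapT => h.
have := @max_poly_roots F q [seq i%:R | i <- iota 0 (size q)] q0.
rewrite size_map size_iota ltnn => H; suff : false by []; apply: H.
  by apply/allP => _ /mapP [m _ ->]; apply: contrapT => /negP nr; apply: h; exists m.
rewrite map_inj_uniq ?iota_uniq // => i j e; wlog le : i j e / (i <= j)%N.
  by move=> W; case/orP: (leq_total i j) => /W -> //; rewrite e.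
apply/eqP; rewrite eqn_leq le /= -subn_eq0.
have /pcharf0P <- := char0; by rewrite natrB // e subrr.
Qed.

Section Transcendental.
Variables (F L : fieldType) (iota : {rmorphism F -> L}) (t : L).
Hypothesis char0 : [pchar L] =i pred0.
Hypothesis places : has_odd_places F.
Hypothesis transc : ~ algebraicOver iota t.

Let ev (f : {poly F}) : L := (map_poly iota f).[t].

Let evM f g : ev (f * g) = ev f * ev g.
Proof. by rewrite /ev rmorphM hornerM. Qed.
Let evB f g : ev (f - g) = ev f - ev g.
Proof. by rewrite /ev rmorphB hornerD hornerN. Qed.
Let evC a : ev a%:P = iota a.
Proof. by rewrite /ev map_polyC hornerC. Qed.
Let ev_eq0 f : (ev f == 0) = (f == 0).
Proof.
apply/idP/idP => [h|/eqP ->]; last by rewrite /ev rmorph0 horner0.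
by apply: contrapT => /negP f0; apply: transc; exists f.
Qed.
Lemma transcendental_field :
  exists (F' : fieldType) (iota' : {rmorphism F' -> L}), forall y,
    (exists f g, g != 0 /\ y = ev f / ev g) <-> exists x, y = iota' x.
Proof.
apply: exists_subfield => [|_ _ [f [g [g0 ->]]] [f' [g' [g0' ->]]]|
  _ _ [f [g [g0 ->]]] [f' [g' [g0' ->]]]].
- by exists 1, 1; rewrite oner_eq0 divff // ev_eq0 oner_eq0.
- exists (f * g' - f' * g), (g * g'); rewrite mulf_neq0 //; split=> //.
  by rewrite evB !evM; field; rewrite !ev_eq0 g0 g0'.
- have [->|f0'] := eqVneq f' 0.
    exists 0, 1; rewrite oner_eq0; split=> //.
    by have /eqP -> : ev 0 == 0; rewrite ?ev_eq0 // !mul0r invr0 mulr0.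
  exists (f * g'), (g * f'); rewrite mulf_neq0 //; split=> //.
  by rewrite !evM; field; rewrite !ev_eq0 g0 g0' f0'.
Qed.

Section Extension.
Variables (F' : fieldType) (iota' : {rmorphism F' -> L}).
Hypothesis iotaP : forall y,
  (exists f g, g != 0 /\ y = ev f / ev g) <-> exists x, y = iota' x.

Lemma fractionP x : exists f g, g != 0 /\ iota' x = ev f / ev g.
Proof. by apply/iotaP; exists x. Qed.

Section ExtendPlace.
Variables (kappa : fieldType) (R : F -> kappa -> Prop) (p : nat) (n : F).
Hypotheses (placeR : is_place R) (oddR : odd_at R p).

(** The place of F(t) at t = n, with values in F. Composed with [R] it gives [extended]. *)
Definition centered (y : F') (a : F) :=
  exists f g, [/\ g.[n] != 0, iota' y = ev f / ev g & a = f.[n] / g.[n]].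

Definition extended y r := exists2 a, centered y a & R a r.

Lemma nonroot_neq0 (g : {poly F}) : g.[n] != 0 -> g != 0.
Proof. by apply: contraNneq => ->; rewrite horner0. Qed.

Lemma centeredB x a y b : centered x a -> centered y b -> centered (x - y) (a - b).
Proof.
move=> [f [g [g0 ex ->]]] [f' [g' [g0' ey ->]]].
exists (f * g' - f' * g), (g * g'); rewrite !hornerE mulf_neq0 //.
rewrite rmorphB ex ey evB !evM; split=> //; field; rewrite ?g0 ?g0' //.
by rewrite !ev_eq0 !nonroot_neq0.
Qed.

Lemma centeredM x a y b : centered x a -> centered y b -> centered (x * y) (a * b).
Proof.
move=> [f [g [g0 ex ->]]] [f' [g' [g0' ey ->]]].
exists (f * f'), (g * g'); rewrite !hornerM mulf_neq0 //.
by rewrite rmorphM ex ey !evM; split=> //; rewrite mulf_div.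
Qed.

(** The multiplicities of X - n in numerator and denominator are compared. *)
Lemma centered_cases x : x != 0 ->
  (exists2 a, centered x a & a != 0) \/ centered x 0 \/ centered x^-1 0.
Proof.
move=> x0; have [f [g [g0 e]]] := fractionP x.
have f0 : f != 0.
  apply: contraNneq x0 => f0; rewrite -(fmorph_eq0 iota') e f0 mulf_eq0.
  by rewrite ev_eq0 eqxx.
have [i [f1 /implyP /(_ f0) rf ef]] := multiplicity_XsubC f n.
have [j [g1 /implyP /(_ g0) rg eg]] := multiplicity_XsubC g n.
set h := 'X - n%:P in ef eg.
have h0 : ev h != 0 by rewrite ev_eq0 polyXsubC_eq0.
have hn : h.[n] = 0 by rewrite /h !hornerE subrr.
have evX k : ev (h ^+ k) = ev h ^+ k by rewrite /ev rmorphXn horner_exp.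
have f10 : ev f1 != 0 by rewrite ev_eq0 nonroot_neq0.
have g10 : ev g1 != 0 by rewrite ev_eq0 nonroot_neq0.
case: (ltngtP i j) => [lt|lt|eij].
- right; right; exists (g1 * h ^+ (j - i)), f1; split=> //.
    rewrite fmorphV e ef eg !evM !evX -{1}(subnK (ltnW lt)) exprD.
    by field; rewrite ?expf_neq0 ?f10 ?g10 ?h0.
  by rewrite hornerM horner_exp hn expr0n subn_eq0 leqNgt lt mulr0 mul0r.
- right; left; exists (f1 * h ^+ (i - j)), g1; split=> //.
    rewrite e ef eg !evM !evX -{1}(subnK (ltnW lt)) exprD.
    by field; rewrite ?expf_neq0 ?f10 ?g10 ?h0.
  by rewrite hornerM horner_exp hn expr0n subn_eq0 leqNgt lt mulr0 mul0r.
left; exists (f1.[n] / g1.[n]); last by rewrite mulf_neq0 // invr_eq0.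
exists f1, g1; split=> //; rewrite e ef eg eij !evM !evX.
by field; rewrite ?expf_neq0 ?g10 ?h0.
Qed.

Lemma centered_uniq x a b : centered x a -> centered x b -> a = b.
Proof.
move=> /centeredB h /h; rewrite subrr => -[f [g [g0 e e2]]].
apply/eqP; rewrite -subr_eq0 e2; move/eqP: e.
rewrite rmorph0 eq_sym mulf_eq0 invr_eq0 !ev_eq0 (negPf (nonroot_neq0 g0)) orbF.
by move/eqP ->; rewrite horner0 mul0r.
Qed.

Lemma centeredC (x : F') a : iota' x = iota a -> centered x a.
Proof.
move=> e; exists a%:P, 1; rewrite !hornerE oner_eq0; split=> //.
  by rewrite e evC /ev rmorph1 hornerC divr1.
by rewrite divr1.
Qed.

Lemma centeredV x a : centered x a -> a != 0 -> centered x^-1 a^-1.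
Proof.
move=> [f [g [g0 e ea]]] a0; exists g, f; rewrite fmorphV e ea !invf_div.
by split=> //; move: a0; rewrite ea; apply: contraNneq => ->; rewrite mul0r.
Qed.

Lemma extended_place : is_place extended.
Proof.
have [R1 RB RM R0 RT] := placeR.
have z0 : R 0 0 by have := RB _ _ _ _ R1 R1; rewrite !subrr.
split.
- by exists 1 => //; apply: centeredC; rewrite !rmorph1.
- by move=> x r y s [a ha ra] [b hb rb]; exists (a - b);
    [apply: centeredB | apply: RB].
- by move=> x r y s [a ha ra] [b hb rb]; exists (a * b);
    [apply: centeredM | apply: RM].
- move=> r [a ha ra]; apply: R0.
  suff <- : a = 0 by [].
  by apply: centered_uniq ha _; apply: centeredC; rewrite !rmorph0.
- move=> x /centered_cases [[a ha a0]|[ha|ha]].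
  + case: (RT a a0) => [[r hr]|h]; first by left; exists r, a.
    by right; exists a^-1 => //; apply: centeredV.
  + by left; exists 0, 0.
  + by right; exists 0.
Qed.

(** As a nonzero constant, p is a unit at t = n. If g is a unit there, oddness of [R] applies; if g
    vanishes there, so does g^2 / p; and a pole of g would prevent g^2 / p from having a value. *)
Lemma extended_odd : odd_at extended p.
Proof.
have [R1 RB RM R0 RT] := placeR; have [p0 Rp hp] := oddR.
have pC : centered p%:R p%:R by apply: centeredC; rewrite !rmorph_nat.
have p0' : p%:R != 0 :> F.
  have /pcharf0P -> : [pchar F] =i pred0 by move=> q;
    rewrite -(fmorph_pchar iota) char0.
  by rewrite -lt0n.
split=> //; first by exists p%:R.
move=> g r [a ha ra].
have zC : centered 0 0 by apply: centeredC; rewrite !rmorph0.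
have [e|g0] := eqVneq g 0.
  apply: R0; suff <- : a = 0 by [].
  by apply: centered_uniq ha _; rewrite e expr0n mul0r.
case: (centered_cases g0) => [[b hb b0]|[hb|hb]].
- apply: (hp b); suff <- : a = b ^+ 2 / p%:R by [].
  apply: centered_uniq ha _; apply: centeredM; last exact: centeredV.
  by rewrite !expr2; apply: centeredM.
- apply: R0; suff <- : a = 0 by [].
  apply: centered_uniq ha _; rewrite (_ : 0 = 0 * 0 / p%:R); last by rewrite !mul0r.
  apply: centeredM; last exact: centeredV.
  by rewrite expr2; apply: centeredM.
- suff : 1 = 0 :> F by move/eqP; rewrite oner_eq0.
  apply: (@centered_uniq 1); first by apply: centeredC; rewrite !rmorph1.
  rewrite (_ : 0 = a * p%:R * (0 * 0)); last by rewrite !mulr0.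
  rewrite (_ : 1 = g ^+ 2 / p%:R * p%:R * (g^-1 * g^-1)).
    by do ![apply: centeredM => //].
  field; rewrite g0 -(fmorph_eq0 iota') rmorph_nat.
  by have /pcharf0P -> := char0; rewrite -lt0n.
Qed.
End ExtendPlace.

Lemma extension_has_odd_places : has_odd_places F'.
Proof.
move=> l.
have charF : [pchar F] =i pred0 by move=> q; rewrite -(fmorph_pchar iota) char0.
(* [q] is a product of denominators: at an integer that is not a root of [q], all listed elements
   have values in F, and a place of F finite at these values is extended. *)
have [q q0 hq] : exists2 q : {poly F}, q != 0 & forall n, ~~ root q n ->
    {in l, forall y, exists a, centered n y a}.
  elim: l => [|y l [q q0 hq]]; first by exists 1; rewrite ?oner_eq0.
  have [f [g [g0 e]]] := fractionP y.
  exists (g * q); first by rewrite mulf_neq0.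
  move=> n; rewrite rootM negb_or => /andP [rg rq] z.
  rewrite inE => /orP [/eqP ->|]; last exact: hq.
  by exists (f.[n] / g.[n]), f, g.
have [m rm] := nonroot_nat charF q0.
have [l' hl'] := seq_choice (hq _ rm).
have [kappa [R [p [hR hp hl]]]] := places l'.
exists kappa, (extended R m%:R), p; split.
- exact: extended_place.
- exact: extended_odd.
by move=> y /hl' [a /hl [r hr] ha]; exists r, a.
Qed.
End Extension.

Lemma transcendental_extension :
  exists (F' : fieldType) (iota' : {rmorphism F' -> L}) (j : F -> F'),
  [/\ has_odd_places F', forall a, iota' (j a) = iota a & exists x, t = iota' x].
Proof.
have [F' [iota' iotaP]] := transcendental_field.
have ev1 : ev 1 = 1 by rewrite /ev rmorph1 hornerC.
have hj a : exists b, iota' b = iota a.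
  have [|b e] := (iotaP (iota a)).1; last by exists b.
  by exists a%:P, 1; rewrite oner_eq0 evC ev1 divr1.
exists F', iota', (fun a => projT1 (cid (hj a))); split.
- exact: extension_has_odd_places.
- by move=> a; case: cid.
apply/iotaP; exists 'X, 1; rewrite oner_eq0 ev1 divr1; split=> //.
by rewrite /ev map_polyX hornerX.
Qed.
End Transcendental.

(** * Unramified algebraic extensions *)

Lemma separable_dvd_sqr (F : fieldType) (g c : {poly F}) :
  coprimep g g^`() -> g %| c ^+ 2 -> g %| c.
Proof.
move=> sep; have [g0|g0] := eqVneq g 0; first by rewrite g0 !dvd0p expf_eq0.
have /separable_polyP [sq _] : separable_poly g by rewrite separable_poly.unlock.
set d := gcdp g c; have d0 : d != 0 by rewrite gcdp_eq0 negb_and g0.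
have eg : g = g %/ d * d by rewrite divpK ?dvdp_gcdl.
have ec : c = c %/ d * d by rewrite divpK ?dvdp_gcdr.
have cop : coprimep (g %/ d) (c %/ d) by rewrite coprimep_div_gcd // g0.
rewrite {1}eg {1}ec exprMn expr2 [d ^+ 2]expr2 mulrA dvdp_mul2r //.
rewrite Gauss_dvdpr ?coprimepMr ?cop // => h.
(* Now g / d divides d, while g is square-free; so g / d is constant. *)
have u1 : (g %/ d) %= 1.
  have := sq (g %/ d) d; rewrite -eg dvdpp => /(_ isT) /coprimepP /(_ (g %/ d)).
  by apply.
by rewrite eg (eqp_dvdl _ (eqp_mulr d u1)) mul1r dvdp_gcdr.
Qed.

(** * Reduction of polynomials at a place *)

Section Residue.
Variables (F kappa : fieldType) (R : F -> kappa -> Prop).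
Hypothesis placeR : is_place R.

Let R1 : R 1 1. Proof. by case: placeR. Qed.
Let RB x r y s : R x r -> R y s -> R (x - y) (r - s).
Proof. by case: placeR => _ + _ _ _; apply. Qed.
Let RM x r y s : R x r -> R y s -> R (x * y) (r * s).
Proof. by case: placeR => _ _ + _ _; apply. Qed.
Let R00 : R 0 0. Proof. by rewrite -(subrr 1) -[X in R _ X](subrr 1); apply: RB. Qed.

Lemma place_uniq x r s : R x r -> R x s -> r = s.
Proof.
move=> hr hs; apply/eqP; rewrite -subr_eq0; apply/eqP.
by case: placeR => _ _ _ + _; apply; rewrite -(subrr x); apply: RB.
Qed.

Definition residue x : kappa := if pselect (finite_at R x) is left h
  then projT1 (cid h) else 0.

Lemma residueE x r : R x r -> residue x = r.
Proof.
rewrite /residue; case: pselect => [h|h hr]; last by case: h; exists r.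
by case: cid => s /= hs hr; exact: place_uniq hs hr.
Qed.

Lemma finiteP x : finite_at R x -> R x (residue x).
Proof. by move=> [r hr]; rewrite (residueE hr). Qed.

Lemma finite_subring : subring (finite_at R).
Proof.
split=> [|x y [r hr] [s hs]|x y [r hr] [s hs]]; first by exists 1.
  by exists (r - s); apply: RB.
by exists (r * s); apply: RM.
Qed.

Lemma residue0 : residue 0 = 0. Proof. exact: residueE. Qed.
Lemma residue1 : residue 1 = 1. Proof. exact: residueE. Qed.
Lemma residueB x y : finite_at R x -> finite_at R y ->
  residue (x - y) = residue x - residue y.
Proof. by move=> hx hy; apply: residueE; apply: RB; apply: finiteP. Qed.
Lemma residueM x y : finite_at R x -> finite_at R y ->
  residue (x * y) = residue x * residue y.
Proof. by move=> hx hy; apply: residueE; apply: RM; apply: finiteP. Qed.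
Lemma residueN x : finite_at R x -> residue (- x) = - residue x.
Proof.
move=> hx; rewrite -sub0r residueB ?residue0 ?sub0r //.
exact: (subring0 finite_subring).
Qed.
Lemma residueD x y : finite_at R x -> finite_at R y ->
  residue (x + y) = residue x + residue y.
Proof.
move=> hx hy; rewrite -{1}[y]opprK residueB ?residueN ?opprK //.
exact: (subringN finite_subring).
Qed.
Lemma residueMn x n : finite_at R x -> residue (x *+ n) = residue x *+ n.
Proof.
move=> hx; elim: n => [|n IH]; first by rewrite !mulr0n residue0.
rewrite !mulrS residueD ?IH //; rewrite -mulr_natl.
by apply: (subringM finite_subring) => //; apply: (subring_nat finite_subring).
Qed.

Lemma residue_sum (I : Type) (s : seq I) (f : I -> F) :
  (forall i, finite_at R (f i)) ->
  residue (\sum_(i <- s) f i) = \sum_(i <- s) residue (f i).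
Proof.
move=> h; elim: s => [|i s IH]; first by rewrite !big_nil residue0.
by rewrite !big_cons residueD ?IH //; apply: (subring_sum finite_subring).
Qed.

Local Notation finp := (over (finite_at R)).

Definition respoly (f : {poly F}) := \poly_(i < size f) residue f`_i.

Lemma coef_respoly f i : (respoly f)`_i = residue f`_i.
Proof.
rewrite coef_poly; case: ltnP => // h; by rewrite nth_default // residue0.
Qed.

Lemma size_respoly f : (size (respoly f) <= size f)%N.
Proof. exact: size_poly. Qed.

Lemma finpB f g : finp f -> finp g -> finp (f - g).
Proof. by move=> hf hg i; rewrite coefB; apply: (subringB finite_subring). Qed.

Lemma finpM f g : finp f -> finp g -> finp (f * g).
Proof.
move=> hf hg i; rewrite coefM; apply: (subring_sum finite_subring) => j _.
exact: (subringM finite_subring).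
Qed.

Lemma finp1 : finp 1.
Proof. by move=> i; rewrite coef1; apply: (subring_nat finite_subring). Qed.

Lemma finpXn n : finp 'X^n.
Proof. by move=> i; rewrite coefXn; apply: (subring_nat finite_subring). Qed.

Lemma finpZ a f : finite_at R a -> finp f -> finp (a *: f).
Proof. by move=> ha hf i; rewrite coefZ; apply: (subringM finite_subring). Qed.

Lemma respolyB f g : finp f -> finp g -> respoly (f - g) = respoly f - respoly g.
Proof.
by move=> hf hg; apply/polyP => i; rewrite coefB !coef_respoly coefB residueB.
Qed.

Lemma respolyD f g : finp f -> finp g -> respoly (f + g) = respoly f + respoly g.
Proof.
by move=> hf hg; apply/polyP => i; rewrite coefD !coef_respoly coefD residueD.
Qed.

Lemma respolyM f g : finp f -> finp g -> respoly (f * g) = respoly f * respoly g.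
Proof.
move=> hf hg; apply/polyP => i; rewrite coef_respoly !coefM residue_sum.
  by apply: eq_bigr => j _; rewrite !coef_respoly residueM.
by move=> j; apply: (subringM finite_subring).
Qed.

Lemma respolyZ a f : finite_at R a -> finp f ->
  respoly (a *: f) = residue a *: respoly f.
Proof.
by move=> ha hf; apply/polyP => i; rewrite coefZ !coef_respoly coefZ residueM.
Qed.

Lemma respoly1 : respoly 1 = 1.
Proof.
apply/polyP => i; rewrite coef_respoly !coef1.
by case: (i == 0%N); [exact: residue1 | exact: residue0].
Qed.

Lemma respoly_deriv f : finp f -> respoly f^`() = (respoly f)^`().
Proof.
by move=> hf; apply/polyP => i;
  rewrite coef_respoly !coef_deriv coef_respoly residueMn.
Qed.

Lemma size_respoly_monic g : g \is monic -> size (respoly g) = size g.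
Proof.
move=> /monicP mg; apply/eqP; rewrite eqn_leq size_respoly /= leqNgt.
apply/negP => lt; have := residue1; rewrite -mg lead_coefE -coef_respoly.
rewrite nth_default => [/esym /eqP|]; first by rewrite oner_eq0.
by rewrite -ltnS (leq_trans lt) // leqSpred.
Qed.

(** Division by a monic polynomial creates no denominators: leading terms are removed one at a time,
    by induction on the size of [h]. *)
Lemma respoly_dvd g h : g \is monic -> finp g -> finp h ->
  g %| h -> respoly g %| respoly h.
Proof.
move=> mg hg; have [N] := ubnP (size h); elim: N h => // N IH h.
rewrite ltnS => le hh dv.
have [->|h0] := eqVneq h 0.
  suff -> : respoly 0 = 0 by exact: dvdp0.
  by apply/polyP => i; rewrite coef_respoly !coef0 residue0.
pose m : {poly F} := lead_coef h *: 'X^(size h - size g) * g.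
have hq : finp (lead_coef h *: 'X^(size h - size g)).
  by apply: finpZ; [rewrite lead_coefE | exact: finpXn].
have hm : finp m by exact: finpM.
have sz := dvdp_leq h0 dv.
have g0 := monic_neq0 mg.
have sgh : (0 < size g)%N by rewrite lt0n size_poly_eq0.
have sm : size m = size h.
  rewrite size_Mmonic ?size_scale ?lead_coef_eq0 //; last first.
    by rewrite scaler_eq0 lead_coef_eq0 negb_or h0 -size_poly_eq0 size_polyXn.
  by rewrite size_polyXn addSn /= subnK.
have lm : lead_coef m = lead_coef h.
  by rewrite lead_coef_Mmonic // lead_coefZ lead_coefXn mulr1.
have lt : (size (h - m)%R < N)%N.
  apply: leq_trans le.
  have hs : (0 < size h)%N by rewrite lt0n size_poly_eq0.
  rewrite -(prednK hs) ltnS; apply/leq_sizeP => i hi; rewrite coefB.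
  case: (ltngtP i (size h).-1) hi => // [lti _|-> _].
    by rewrite !nth_default ?subrr // ?sm -(prednK hs).
  by rewrite -lead_coefE -lm lead_coefE sm subrr.
have -> : h = (h - m) + m by rewrite subrK.
rewrite respolyD //; last exact: finpB.
rewrite dvdp_add //; last by rewrite respolyM ?dvdp_mull.
apply: IH => //; first exact: finpB.
by rewrite dvdp_sub // dvdp_mull.
Qed.

(** An entry of largest absolute value for the place; dividing a polynomial by such a coefficient
    makes its reduction defined and nonzero. *)
Lemma exists_dominant (l : seq F) : has (fun x => x != 0) l ->
  exists2 m, m \in l & m != 0 /\ {in l, forall x, finite_at R (x / m)}.
Proof.
elim: l => // x l IH hx.
case: (boolP (has (fun x => x != 0) l)) => [/IH [m ml [m0 hm]]|nh]; last first.
  move: hx; rewrite /= (negPf nh) orbF => x0; exists x; first exact: mem_head.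
  split=> // y; rewrite inE => /orP [/eqP ->|yl]; first by rewrite divff //;
    exists 1.
  move/hasPn: nh => /(_ y yl) /negbNE /eqP ->; rewrite mul0r; by exists 0.
case: (pselect (finite_at R (x / m))) => hxm.
  exists m; first by rewrite inE ml orbT.
  by split=> // y; rewrite inE => /orP [/eqP ->|/hm].
have x0 : x != 0 by apply: contra_notN hxm => /eqP ->; rewrite mul0r; exists 0.
have [_ _ _ _ /(_ (x / m))] := placeR.
rewrite mulf_neq0 ?invr_eq0 // => /(_ isT) [//|hmx].
exists x; first exact: mem_head.
split=> // y; rewrite inE => /orP [/eqP ->|/hm hy].
  by rewrite divff //; exists 1.
rewrite (_ : y / x = y / m * (x / m)^-1); last by field; rewrite x0 m0.
by apply: (subringM finite_subring) => //; exists 0.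
Qed.

End Residue.

(** * Simple algebraic extensions F(z) *)

Section Algebraic.
Variables (F L : fieldType) (iota : {rmorphism F -> L}) (z : L).
Hypothesis char0 : [pchar L] =i pred0.
Hypothesis places : has_odd_places F.
Hypothesis algz : algebraicOver iota z.

Let ev (f : {poly F}) : L := (map_poly iota f).[z].
Let evM f g : ev (f * g) = ev f * ev g.
Proof. by rewrite /ev rmorphM hornerM. Qed.
Let evB f g : ev (f - g) = ev f - ev g.
Proof. by rewrite /ev rmorphB hornerD hornerN. Qed.
Let evD f g : ev (f + g) = ev f + ev g.
Proof. by rewrite /ev rmorphD hornerD. Qed.
Let evZ a f : ev (a *: f) = iota a * ev f.
Proof. by rewrite /ev map_polyZ hornerZ. Qed.
Let ev1 : ev 1 = 1.
Proof. by rewrite /ev rmorph1 hornerC. Qed.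

Lemma exists_minpoly : exists g, [/\ g \is monic, irreducible_poly g &
  forall f, (ev f == 0) = (g %| f)].
Proof.
pose Q n := `[< exists f : {poly F},
  [/\ f != 0, root (map_poly iota f) z & size f = n] >].
have exQ : exists n, Q n.
  by case: algz => f f0 rf; exists (size f); apply/asboolP; exists f.
case: (ex_minnP exQ) => n /asboolP [f [f0 rf sf]] minn.
pose g : {poly F} := (lead_coef f)^-1 *: f.
have l0 : (lead_coef f)^-1 != 0 by rewrite invr_eq0 lead_coef_eq0.
have g0 : g != 0 by rewrite scaler_eq0 negb_or l0.
have rg : root (map_poly iota g) z.
  by rewrite /root -/(ev g) evZ; have /eqP -> : ev f == 0 := rf; rewrite mulr0.
have ming h : root (map_poly iota h) z -> h != 0 -> (size g <= size h)%N.
  by move=> rh h0; rewrite size_scale // sf; apply: minn; apply/asboolP; exists h.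
exists g; split.
- by rewrite monicE lead_coefZ mulVf // lead_coef_eq0.
- by apply/(subfx_irreducibleP rg g0).
move=> h; apply/idP/idP => [rh|/dvdpP [q ->]]; last first.
  by rewrite evM; have /eqP -> : ev g == 0 := rg; rewrite mulr0.
rewrite /dvdp; apply: contrapT => /negP m0.
have : (size g <= size (h %% g)%R)%N.
  apply: ming => //; rewrite /root -/(ev _).
  move: rh; rewrite {1}(divp_eq h g) evD evM.
  by have /eqP -> : ev g == 0 := rg; rewrite mulr0 add0r.
by rewrite leqNgt ltn_modp g0.
Qed.

Definition generated_field : set L := [set y | exists f, y = ev f].

Lemma generated_field_closed :
  [/\ generated_field 1,
   forall x y, generated_field x -> generated_field y -> generated_field (x - y) &
   forall x y, generated_field x -> generated_field y -> generated_field (x / y)].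
Proof.
split; first by exists 1.
  by move=> _ _ [f ->] [h ->]; exists (f - h).
move=> _ _ [f ->] [h ->].
have [g [mg irr kerg]] := exists_minpoly.
have [h0|h0] := eqVneq (ev h) 0.
  by exists 0; rewrite h0 invr0 mulr0 /ev rmorph0 horner0.
have : coprimep g h by rewrite irreducible_poly_coprime // -kerg.
move=> /Bezout_eq1_coprimepP [[u v] /= e].
exists (f * v); rewrite evM; congr (_ * _).
apply: (mulIf h0); rewrite mulVf // -evM -ev1 -e evD evM.
by have /eqP -> : ev g == 0; rewrite ?kerg ?dvdpp // mulr0 add0r.
Qed.

(** [BB] consists of the values at z of polynomials finite at a place of F, and e q = 1 + p r makes
    e a unit modulo p. So p does not become a square times such a unit in F(z), because the minimal
    polynomial of z stays separable in reduction. *)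
Lemma algebraic_unramified (l : seq L) : {in l, forall y, generated_field y} ->
  exists (BB : set L) (p : nat), [/\ subring BB, {in l, forall y, BB y}, (0 < p)%N &
    forall S e q r, generated_field S -> BB e -> BB q -> BB r ->
      S ^+ 2 = p%:R * e -> e * q = 1 + p%:R * r -> False].
Proof.
move=> /seq_choice [m hm].
have [g [mg irr kerg]] := exists_minpoly.
have charF : [pchar F] =i pred0 by move=> q; rewrite -(fmorph_pchar iota) char0.
have g0 := monic_neq0 mg.
have sg : (1 < size g)%N by case: irr.
(* The place will be taken finite on this Bezout relation, which then reduces to one between the
   reduction of [g] and its derivative. *)
have [u [w euw]] : exists u w, u * g + w * g^`() = 1.
  suff /Bezout_eq1_coprimepP [[u w] e] : coprimep g g^`() by exists u, w.
  rewrite irreducible_poly_coprime //; apply/negP => dv.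
  have d0 : g^`() != 0.
    apply/eqP => /polyP /(_ (size g).-2); rewrite coef_deriv coef0.
    have -> : (size g).-2.+1 = (size g).-1 by rewrite prednK // -subn1 subn_gt0.
    rewrite -lead_coefE (monicP mg) => /eqP; have /pcharf0P -> := charF.
    by rewrite -subn1 subn_eq0 leqNgt sg.
  by have := dvdp_leq d0 dv; rewrite leqNgt lt_size_deriv.
have [kappa [R [p [hR [p0 Rp hodd] hfin]]]] :=
  places (flatten [seq polyseq f | f <- [:: g, u, w & m]]).
have fin f : f \in [:: g, u, w & m] -> over (finite_at R) f.
  move=> hf i; case: (ltnP i (size f)) => hi; last first.
    by rewrite nth_default //; apply: (subring0 (finite_subring hR)).
  by apply: hfin; apply/flatten_mapP; exists f => //; exact: mem_nth.
have fg : over (finite_at R) g by apply: fin; rewrite !inE eqxx.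
have fu : over (finite_at R) u by apply: fin; rewrite !inE eqxx orbT.
have fw : over (finite_at R) w by apply: fin; rewrite !inE eqxx !orbT.
pose gb := respoly R g.
have sgb : size gb = size g by apply: size_respoly_monic.
have rp : residue R p%:R = 0 by apply: residueE.
have fp : finite_at R p%:R by exists 0.
have p0F : p%:R != 0 :> F by have /pcharf0P -> := charF; rewrite -lt0n.
have sep : coprimep gb gb^`().
  apply/Bezout_eq1_coprimepP; exists (respoly R u, respoly R w) => /=.
  have fg' : over (finite_at R) g^`().
    move=> i; rewrite coef_deriv -mulr_natl;
      apply: (subringM (finite_subring hR)) => //.
    exact: (subring_nat (finite_subring hR)).
  rewrite -respoly_deriv // -!respolyM // -respolyD //; try exact: finpM.
  by rewrite euw respoly1.
have res_dvd f : over (finite_at R) f -> ev f = 0 -> gb %| respoly R f.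
  by move=> hf e; apply: respoly_dvd => //; rewrite -kerg e.
exists [set y | exists2 f, over (finite_at R) f & y = ev f], p; split=> //.
- split; first by exists 1 => //; exact: finp1.
    by move=> _ _ [f hf ->] [h hh ->]; exists (f - h) => //; exact: finpB.
  by move=> _ _ [f hf ->] [h hh ->]; exists (f * h) => //; exact: finpM.
- by move=> y /hm [f hf e]; exists f => //; apply: fin; rewrite !inE hf !orbT.
move=> _ _ _ _ [f ->] [e he ->] [q hq ->] [r hr ->] eS eu.
have unit_e : gb %| respoly R e * respoly R q - 1.
  have := @res_dvd (e * q - 1 - p%:R *: r).
  have f1 : over (finite_at R) 1 by exact: finp1.
  have fe : over (finite_at R) (e * q) by exact: finpM.
  have fr : over (finite_at R) (p%:R *: r) by exact: finpZ.
  rewrite !respolyB ?respolyM ?respolyZ ?respoly1 // ?rp ?scale0r ?subr0;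
    try exact: finpB.
  apply; first by do ![apply: finpB => //].
  by rewrite !evB evM ev1 evZ rmorph_nat eu [1 + _]addrC addrK subrr.
have not_dvd_e : ~~ (gb %| respoly R e).
  apply/negP => dv; have := dvdp_sub (dvdp_mulr (respoly R q) dv) unit_e.
  by rewrite subKr dvdp1 sgb => /eqP h; move: sg; rewrite h.
pose f1 := f %% g.
have ef1 : ev f = ev f1.
  rewrite {1}(divp_eq f g) evD evM.
  by have /eqP -> : ev g == 0; rewrite ?kerg ?dvdpp // mulr0 add0r.
have sf1 : (size f1 < size g)%N by rewrite ltn_modp.
have [f10|f10] := eqVneq f1 0.
  case/negP: not_dvd_e; apply: res_dvd => //.
  move/eqP: eS; rewrite ef1 f10 /ev rmorph0 horner0 expr0n eq_sym mulf_eq0.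
  have /pcharf0P -> := char0; rewrite -leqn0 leqNgt p0 /=; exact/eqP.
have [|m0 m0f [m0n hm0]] := @exists_dominant _ _ _ hR (polyseq f1).
  apply/hasP; exists (lead_coef f1); last by rewrite lead_coef_eq0.
  by rewrite lead_coefE mem_nth // prednK // lt0n size_poly_eq0.
(* The reduction of [c] is nonzero and of degree below that of [gb], hence not divisible by [gb]. *)
pose c := m0^-1 *: f1.
have fc : over (finite_at R) c.
  move=> i; rewrite coefZ mulrC; case: (ltnP i (size f1)) => hi.
    by apply: hm0; exact: mem_nth.
  by rewrite nth_default // mul0r; apply: (subring0 (finite_subring hR)).
have c_neq0 : respoly R c != 0.
  have [i hi ei] := nthP 0 m0f.
  apply/eqP => /polyP /(_ i); rewrite coef_respoly // coef0 coefZ ei mulVf //.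
  by rewrite residue1 // => /eqP; rewrite oner_eq0.
have not_dvd_c : ~~ (gb %| respoly R c).
  apply/negP => dv; have := dvdp_leq c_neq0 dv; rewrite leqNgt sgb.
  rewrite (leq_ltn_trans (size_respoly _ _)) // (leq_ltn_trans _ sf1) //.
  exact: size_scale_leq.
pose theta := m0 ^+ 2 / p%:R.
have eth : iota theta * ev c ^+ 2 = ev e.
  have p0L : p%:R != 0 :> L by have /pcharf0P -> := char0; rewrite -lt0n.
  apply: (mulfI p0L); rewrite -eS ef1 /c evZ rmorphM fmorphV rmorph_nat.
  by rewrite fmorphV rmorphXn /=; field; rewrite p0L fmorph_eq0 m0n.
have th0 : theta != 0 by rewrite mulf_neq0 ?expf_neq0 ?invr_eq0.
have fc2 : over (finite_at R) (c * c) by exact: finpM.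
(* In F(z) one has theta c^2 = e. If theta is finite, oddness makes its residue 0 and [gb] divides
   the reduction of [e], a unit. Otherwise 1 / theta reduces to 0, so [gb] divides the square of the
   reduction of [c], and by separability that reduction itself. *)
have [_ _ _ _ /(_ theta th0)] := hR; case=> [[s hs]|hs].
  have s0 := hodd _ _ hs.
  case/negP: not_dvd_e; have fth : finite_at R theta by exists s.
  have := @res_dvd (e - theta *: (c * c)).
  rewrite respolyB ?respolyZ ?(residueE hR hs) ?s0 ?scale0r ?subr0 //;
    last exact: finpZ.
  apply; first by apply: finpB => //; exact: finpZ.
  by rewrite evB evZ evM -expr2 eth subrr.
case/negP: not_dvd_c; have fth : finite_at R theta^-1 by exists 0.
apply: separable_dvd_sqr => //; rewrite expr2 -respolyM //.
have := @res_dvd (c * c - theta^-1 *: e).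
rewrite respolyB ?respolyZ ?(residueE hR hs) ?scale0r ?subr0 //; last exact: finpZ.
apply; first by apply: finpB => //; exact: finpZ.
rewrite evB evZ evM -eth fmorphV mulKf ?fmorph_eq0 // -expr2 subrr //.
Qed.
End Algebraic.

(** * Escaping the saturation *)

Section FinitelyGeneratedFields.
Variables (L : fieldType) (char0 : [pchar L] =i pred0).

(** The elements are processed one by one, and F grows only at those transcendental over it. *)
Lemma algebraic_over_odd_places (l : seq L) :
  exists (F : fieldType) (iota : {rmorphism F -> L}),
    has_odd_places F /\ {in l, forall y, algebraicOver iota y}.
Proof.
elim: l => [|t l [F [iota [places alg]]]].
  by have [F [iota hF]] := rational_base char0; exists F, iota; split.
case: (pselect (algebraicOver iota t)) => [algt|transc].
  by exists F, iota; split=> // y; rewrite inE => /orP [/eqP ->|/alg].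
have [F' [iota' [j [places' ej [x et]]]]] :=
  transcendental_extension char0 places transc.
exists F', iota'; split=> // y; rewrite inE => /orP [/eqP ->|/alg [q q0 rq]].
  exists ('X - x%:P); first by rewrite polyXsubC_eq0.
  by rewrite rmorphB /= map_polyX map_polyC root_XsubC et.
(* [j] is a bare function compatible with the embeddings, so the polynomial is transported by
   coefficients and compared inside L. *)
have e : map_poly iota' (\poly_(i < size q) j q`_i) = map_poly iota q.
  apply/polyP => i; rewrite !coef_map coef_poly /=.
  by case: ltnP => h; rewrite ?ej // nth_default // !rmorph0.
exists (\poly_(i < size q) j q`_i); last by rewrite e.
by rewrite -(map_poly_eq0 iota') e map_poly_eq0.
Qed.

Lemma primitive_element (F : fieldType) (iota : {rmorphism F -> L}) (l : seq L) :
  {in l, forall y, algebraicOver iota y} ->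
  exists2 z, algebraicOver iota z & {in l, forall y, generated_field iota z y}.
Proof.
have charF : [pchar F] =i pred0 by move=> q; rewrite -(fmorph_pchar iota) char0.
elim: l => [|y l IH] alg.
  exists 0; last by [].
  by exists 'X; rewrite ?polyX_eq0 // map_polyX rootX.
have [|z algz hz] := IH; first by move=> x hx; apply: alg; rewrite inE hx orbT.
have algy := alg y (mem_head _ _).
have [q q0 rq] := algy; have [r r0 rr] := algz.
have [n [[f ef] [g eg]]] := pchar0_PET r0 rr q0 rq charF.
set z' := _ - _ in ef eg; exists z'.
  apply/integral_algebraic; apply: integral_sub; last exact/integral_algebraic.
  rewrite -mulr_natl; apply: integral_mul; last exact/integral_algebraic.
  by rewrite -(rmorph_nat iota); exact: integral_id.
move=> x; rewrite inE => /orP [/eqP ->|/hz [h ->]]; first by exists g.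
by exists (h \Po f); rewrite map_comp_poly horner_comp ef.
Qed.

Definition subfield (KK : set L) :=
  [/\ KK 1, forall x y, KK x -> KK y -> KK (x - y)
    & forall x y, KK x -> KK y -> KK (x / y)].

Lemma subfieldV KK x : subfield KK -> KK x -> KK x^-1.
Proof. by case=> h1 _ hd hx; rewrite -div1r; apply: hd. Qed.

Lemma subfield_subring KK : subfield KK -> subring KK.
Proof.
move=> hK; have [h1 hB hd] := hK; split=> // x y hx hy.
by rewrite -[y]invrK; apply: hd => //; apply: subfieldV.
Qed.

Lemma unramified_subfield (l : seq L) : exists (KK BB : set L) (p : nat),
  [/\ subfield KK, {in l, forall y, KK y}, subring BB, {in l, forall y, BB y} &
   (0 < p)%N /\ forall S e q r, KK S -> BB e -> BB q -> BB r ->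
      S ^+ 2 = p%:R * e -> e * q = 1 + p%:R * r -> False].
Proof.
have [F [iota [places alg]]] := algebraic_over_odd_places l.
have [z algz gen] := primitive_element alg.
have [BB [p [rB hB p0 H]]] := algebraic_unramified char0 places algz gen.
exists (generated_field iota z), BB, p; split=> //.
exact: generated_field_closed.
Qed.
End FinitelyGeneratedFields.

(** * Points of the quadratic twist *)

Section TwistedPoints.
Variables (K : fieldType) (A B : K) (KK : set K) (s : K).
Hypotheses (fKK : subfield KK) (KA : KK A) (KB : KK B).
Hypotheses (s0 : s != 0) (Ks2 : KK (s ^+ 2)).

Let rK := subfield_subring fKK.

(** The image of the [KK]-points of the twist by s^2; for s = 1, points with coordinates in [KK]. *)
Definition twisted (P : option (K * K)) : Prop :=
  if P is Some (a, y) then KK a /\ exists2 b, KK b & y = b * s else True.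

Lemma twisted_neg P : twisted P -> twisted (neg P).
Proof.
case: P => [[a y]|] //= [ha [b hb ->]]; split=> //.
by exists (- b); [exact: (subringN rK) | rewrite mulNr].
Qed.

Lemma twisted_add P Q : twisted P -> twisted Q -> twisted (add A B P Q).
Proof.
case: P => [[x1 y1]|] //; case: Q => [[x2 y2]|] //.
move=> [h1 [b1 hb1 ->]] [h2 [b2 hb2 ->]]; rewrite /add.
case: ifP => // _.
have Kn n : KK n%:R by exact: subring_nat.
have [c hc ->] : exists2 c, KK c & chord A B x1 (b1 * s) x2 (b2 * s) = c * s.
  rewrite /chord; case: ifP => _.
    exists (dcubic A B x1 / (2%:R * b1 * s ^+ 2)).
      have [_ _ hd] := fKK; apply: hd.
        by rewrite /dcubic; do ![apply: (subringD rK) => //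
          |apply: (subringM rK) => //
          |apply: (subringX rK) => //].
      by do ![apply: (subringM rK) => //].
    rewrite (_ : 2%:R * b1 * s ^+ 2 = 2%:R * (b1 * s) * s); last by ring.
    by rewrite [(_ * _ * s)^-1]invfM -[RHS]mulrA divfK.
  exists ((b2 - b1) / (x2 - x1)); last by rewrite -mulrBl mulrAC.
  by have [_ hs hd] := fKK; apply: hd; apply: hs.
rewrite exprMn; have hx : KK (c ^+ 2 * s ^+ 2 - A - x1 - x2).
  by do ![apply: (subringB rK) => //|apply: (subringM rK) => //
    |apply: (subringX rK) => //].
split=> //; move: (_ - x2) hx => x3 hx.
exists (- (c * (x3 - x1) + b1)); last by ring.
apply: (subringN rK); apply: (subringD rK) => //; apply: (subringM rK) => //.
exact: (subringB rK).
Qed.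

Lemma twisted_mul n P : twisted P -> twisted (mul A B n P).
Proof. by move=> hP; elim: n => [|n IH] //=; apply: twisted_add. Qed.
End TwistedPoints.

(** * From Weierstrass equations to y^2 = cubic *)

Section CompletingSquare.
Variables (K : fieldType) (E : elliptic_curve K).
Hypothesis two_neq0 : 2%:R != 0 :> K.

Definition short2 := a2 E + a1 E ^+ 2 / 4%:R.
Definition short4 := a4 E + a1 E * a3 E / 2%:R.
Definition short6 := a6 E + a3 E ^+ 2 / 4%:R.

Definition complete (P : option (K * K)) :=
  if P is Some (x, y) then Some (x, y + (a1 E * x + a3 E) / 2%:R) else None.

Let four_neq0 : 4%:R != 0 :> K.
Proof. by rewrite (_ : 4%:R = 2%:R * 2%:R) ?mulf_neq0 // -natrM. Qed.

Lemma complete_on x y :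
  on_curve E (Some (x, y)) =
  on_cubic short2 short4 short6 (complete (Some (x, y))).
Proof.
rewrite /= /cubic /short2 /short4 /short6 -subr_eq0 -[RHS]subr_eq0.
by congr (_ == 0); field; rewrite four_neq0 two_neq0.
Qed.

Lemma complete_point_on (P : point E) :
  on_cubic short2 short4 short6 (complete P).
Proof. by case: P => [[[x y]|] h] //; rewrite -complete_on. Qed.

Lemma complete_opp P : complete (opp_coords E P) = neg (complete P).
Proof.
by case: P => [[x y]|] //=; congr (Some (_, _)); field.
Qed.

Lemma complete_add (P Q : point E) :
  complete (add_coords E P Q) = add short2 short4 (complete P) (complete Q).
Proof.
have hP := complete_point_on P; have hQ := complete_point_on Q.
case: P hP => [[[x1 y1]|] h1]; last by [].
case: Q hQ => [[[x2 y2]|] h2]; last by [].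
move=> /= /eqP hQ /eqP hP.
have -> : (x1 == x2) && (y1 + (a1 E * x1 + a3 E) / 2%:R
      == - (y2 + (a1 E * x2 + a3 E) / 2%:R))
    = (x1 == x2) && (y1 == - y2 - a1 E * x2 - a3 E).
  case: (x1 =P x2) => //= ->; rewrite -subr_eq0 -[RHS]subr_eq0.
  by congr (_ == 0); field.
case: ifP => // nopp.
(* Adding (a1 x + a3) / 2 to the ordinates increases every slope by a1 / 2. *)
have el : chord short2 short4 x1 (y1 + (a1 E * x1 + a3 E) / 2%:R)
    x2 (y2 + (a1 E * x2 + a3 E) / 2%:R) = slope E x1 y1 x2 y2 + a1 E / 2%:R.
  rewrite /chord /slope; case: eqP => [ex|/eqP nx]; last first.
    by field; rewrite two_neq0 subr_eq0 eq_sym.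
  (* This denominator is twice the completed ordinate; were it zero, both ordinates would vanish and
     the points would be opposite. *)
  have den : 2%:R * y1 + a1 E * x1 + a3 E != 0.
    have e2 : 2%:R * y1 + a1 E * x1 + a3 E =
        2%:R * (y1 + (a1 E * x1 + a3 E) / 2%:R) by field.
    rewrite e2 mulf_neq0 //; apply/eqP => y0.
    move/negP: nopp; rewrite ex eqxx /= => [[]]; apply/eqP.
    move: hP hQ; rewrite ex in y0 *; rewrite y0 expr0n /= => <- /eqP.
    rewrite sqrf_eq0 => /eqP y0'.
    rewrite (_ : y1 = - ((a1 E * x2 + a3 E) / 2%:R)); last first.
      by apply/eqP; rewrite -addr_eq0 y0.
    rewrite (_ : y2 = - ((a1 E * x2 + a3 E) / 2%:R)); last first.
      by apply/eqP; rewrite -addr_eq0 y0'.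
    by field.
  by rewrite /dcubic /short2 /short4; field; rewrite den four_neq0 two_neq0.
rewrite el /short2; congr (Some (_, _)).
  by field; rewrite four_neq0 two_neq0.
by field; rewrite four_neq0 two_neq0.
Qed.

Lemma complete_mul (P : point E) n :
  complete (coords (P *+ n)) = mul short2 short4 n (complete P).
Proof.
case: n => [|n] //; elim: n => [|n IH].
  by rewrite /mul /= addp0.
by rewrite [P *+ _](_ : _ = P + P *+ n.+1) // /= complete_add IH.
Qed.

(** A double root [e] determines [a4] and [a6] from the other coefficients, and the discriminant
    then vanishes identically. *)
Lemma short_smooth e : cubic short2 short4 short6 e = 0 ->
  dcubic short2 short4 e != 0.
Proof.
move=> f0; apply/eqP => d0; have := discriminant_neq0 E; case/eqP.
have e4 : a4 E = - (3%:R * e ^+ 2 + 2%:R * short2 * e) - a1 E * a3 E / 2%:R.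
  transitivity (a4 E - dcubic short2 short4 e); first by rewrite d0 subr0.
  by rewrite /dcubic /short4; ring.
have e6 : a6 E = - (e ^+ 3 + short2 * e ^+ 2 + short4 * e) - a3 E ^+ 2 / 4%:R.
  transitivity (a6 E - cubic short2 short4 short6 e); first by rewrite f0 subr0.
  by rewrite /cubic /short6; ring.
rewrite /discriminant e6 /short4 e4 /short2.
by field; rewrite two_neq0 four_neq0.
Qed.
End CompletingSquare.

Lemma exists_sqrt_minpoly (k K : fieldType) (iota : {rmorphism k -> K}) (d : k) s :
  s ^+ 2 = iota d -> exists q : {poly k},
  [/\ irreducible_poly q, root (map_poly iota q) s & ((size q).-1 <= 2)%N].
Proof.
move=> es; case: (pselect (exists c, iota c = s)) => [[c ec]|ns].
  exists ('X - c%:P); split; first exact: irredp_XsubC.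
    by rewrite rmorphB /= map_polyX map_polyC root_XsubC /= ec.
  by rewrite size_XsubC.
exists ('X^2 - d%:P); have sz : size ('X^2 - d%:P) = 3%N by rewrite size_XnsubC.
split; last by rewrite sz.
  apply: cubic_irreducible; rewrite ?sz // => r; apply/negP.
  rewrite /root !hornerE subr_eq0 => /eqP er; apply: ns.
  have : s ^+ 2 == (iota r) ^+ 2 by rewrite es -er rmorphXn.
  by rewrite eqf_sqr => /orP [] /eqP ->; [exists r | exists (- r); rewrite rmorphN].
by rewrite /root rmorphB /= map_polyXn map_polyC !hornerE es subrr.
Qed.

(** * A point outside the saturation, over a field of degree at most 2 *)

Section Escape.
Variables (k : fieldType) (char0 : [pchar k] =i pred0).
Variables (kbar : closedFieldType) (iota : {rmorphism k -> kbar}).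
Variables (E : elliptic_curve k).

Let K := kbar.
Let EK := base_change iota E.
Let charK : [pchar K] =i pred0.
Proof. by move=> q; rewrite (fmorph_pchar iota) char0. Qed.
Let two_neq0 : 2%:R != 0 :> K. Proof. by have /pcharf0P -> := charK. Qed.
Let A := short2 EK.
Let B := short4 EK.
Let C := short6 EK.

Let eA : A = iota (short2 E).
Proof. by rewrite /A /short2 /= rmorphD rmorphM fmorphV rmorph_nat rmorphXn. Qed.
Let eB : B = iota (short4 E).
Proof. by rewrite /B /short4 /= rmorphD !rmorphM fmorphV rmorph_nat. Qed.
Let eC : C = iota (short6 E).
Proof. by rewrite /C /short6 /= rmorphD rmorphM fmorphV rmorph_nat rmorphXn. Qed.

Lemma exists_escaping_point (n : nat) (g : 'I_n -> point EK) :
  exists (x : k) (s : K), s ^+ 2 = cubic A B C (iota x) /\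
  forall Q : point EK, complete EK (coords Q) = Some (iota x, s) ->
  forall m : int, m != 0 -> ~ generated g (zmul Q m).
Proof.
have fourK : 4%:R != 0 :> K by have /pcharf0P -> := charK.
have smooth := short_smooth (E := EK) two_neq0.
have [O maxO] := exists_maximal_without_half charK.
have rO : subring O by case: maxO.
have [c [c0 hc hcl]] :=
  common_scaling iota [:: short2 E; short4 E; short6 E] maxO two_neq0.
pose xy (P : point EK) := if complete EK (coords P) is Some (x, y) then [:: x;
  y] else [::].
(* Listing the inverses makes c and 4 units of [BB], and listing the generators makes them rational
   over [KK]; p is chosen afterwards and may depend on c. *)
pose l := [:: A; B; C; iota c; (iota c)^-1;
  4%:R^-1] ++ flatten [seq xy (g i) | i <- enum 'I_n].
have [KK [BB [p [fK lK rB lB [p0 H]]]]] := unramified_subfield charK l.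
have rK := subfield_subring fK.
have inl y : y \in [:: A; B; C; iota c; (iota c)^-1; 4%:R^-1] -> y \in l.
  by move=> h; rewrite mem_cat h.
have [KA KB KC] : [/\ KK A, KK B & KK C].
  by split; apply: lK; apply: inl; rewrite !inE eqxx ?orbT.
have [BA B_B BC] : [/\ BB A, BB B & BB C].
  by split; apply: lB; apply: inl; rewrite !inE eqxx ?orbT.
have [Bc Bc' B4] : [/\ BB (iota c), BB (iota c)^-1 & BB 4%:R^-1].
  by split; apply: lB; apply: inl; rewrite !inE eqxx ?orbT.
have Kc : KK (iota c) by apply: lK; apply: inl; rewrite !inE eqxx ?orbT.
have ic0 : iota c != 0 by rewrite fmorph_eq0.
have pK : p%:R != 0 :> K by have /pcharf0P -> := charK; rewrite -lt0n.
pose u := p%:R * iota c.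
have u0 : u != 0 by rewrite mulf_neq0.
have Op : O p%:R by exact: subring_nat.
have Ou : O u by exact: subringM.
have Oua a : a \in [:: short2 E; short4 E; short6 E] -> O (u * iota a).
  by move=> /hcl h; rewrite /u -mulrA; exact: subringM.
have OuA : O (u * A) by rewrite eA; apply: Oua; rewrite !inE eqxx.
have OuB : O (u * B) by rewrite eB; apply: Oua; rewrite !inE eqxx orbT.
have OuC : O (u * C) by rewrite eC; apply: Oua; rewrite !inE eqxx !orbT.
pose x := (4%:R * (p%:R * c))^-1.
have ex : iota x = (4%:R * u)^-1 by rewrite /x fmorphV !rmorphM !rmorph_nat.
have [s es] : exists s : K, s ^+ 2 = cubic A B C (iota x).
  have /closed_rootP [s] : size ('X^2 - (cubic A B C (iota x))%:P) != 1%N.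
    by rewrite size_XnsubC.
  by rewrite /root !hornerE subr_eq0 => /eqP; exists s.
exists x, s; split=> //.
have Ku : KK u by apply: subringM => //; exact: subring_nat.
have Kx : KK (iota x).
  by rewrite ex; apply: subfieldV => //; apply: subringM => //; exact: subring_nat.
have Ks2 : KK (s ^+ 2).
  by rewrite es /cubic; do ![apply: subringD => //|apply: subringM => //
    |apply: subringX => //].
have nKs : ~ KK s.
  (* Since x = 1 / (4 u) with u = p c, the square of (4 u)^2 s is 4 u (1 + p r) = p e with e = 4 c
     (1 + p r); this e is a unit modulo p because 1 / (4 c) is in [BB]. *)
  move=> Ks; pose r := 4%:R * iota c * (A + B * (4%:R * u) + C * (4%:R * u) ^+ 2).
  have Bn m : BB m%:R by exact: subring_nat.
  have Br : BB r.
    by do ![apply: subringD => //|apply: subringM => //|apply: subringX => //].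
  apply: (H ((4%:R * u) ^+ 2 * s) (4%:R * iota c * (1 + p%:R * r))
            (4%:R^-1 * (iota c)^-1) r) => //.
  - by do ![apply: subringM => //|apply: subringX => //|exact: subring_nat].
  - by do ![apply: subringD => //|apply: subringM => //|exact: subring1].
  - by apply: subringM.
  - rewrite exprMn es ex /cubic /r /u; field.
    by rewrite fourK ic0 pK.
  - by field; rewrite fourK ic0.
have s0 : s != 0 by apply: contra_notN nKs => /eqP ->; exact: subring0.
move=> Q eQ m m0 gen.
(* The subgroup generated by [g] consists of points rational over [KK]. *)
have tw1 (P : point EK) : generated g P -> twisted KK 1 (complete EK (coords P)).
  move=> /(_ (fun P => twisted KK 1 (complete EK (coords P)))); apply.
    split=> // [P1 P2 h1 h2|P1 h1].
      rewrite [coords _](_ : _ = add_coords EK P1 P2) // complete_add //.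
      by apply: twisted_add; rewrite ?oner_eq0 ?expr1n //; exact: subring1.
    rewrite [coords _](_ : _ = opp_coords EK P1) // complete_opp //.
    exact: twisted_neg.
  move=> i; have : {in xy (g i), forall y, KK y}.
    move=> y hy; apply: lK; rewrite mem_cat; apply/orP; right.
    by apply/flatten_mapP; exists i; rewrite ?mem_enum.
  rewrite /xy; case: complete => [[a b]|] //= h; split; first by apply: h;
    rewrite mem_head.
  by exists b; rewrite ?mulr1 //; apply: h; rewrite !inE eqxx orbT.
have hP : on_cubic A B C (Some (iota x, s)) by apply/eqP.
pose N := `|m|%N; have N0 : (0 < N)%N by rewrite absz_gt0.
have tw : twisted KK 1 (mul A B N (Some (iota x, s))).
  have hpos j : generated g (Q *+ j) -> twisted KK 1 (mul A B j (Some (iota x, s))).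
    by move=> /tw1; rewrite complete_mul // eQ.
  rewrite /N; case: m m0 gen N N0 => j m0 gen _ _; first exact: hpos.
  move/tw1: gen; rewrite [coords _](_ : _ = opp_coords EK (Q *+ j.+1)) //.
  rewrite complete_opp // complete_mul // eQ => /(twisted_neg fK).
  by rewrite negK.
have tws : twisted KK s (mul A B N (Some (iota x, s))).
  apply: twisted_mul => //; split=> //.
  by exists 1; rewrite ?mul1r //; exact: subring1.
have nt j : (0 < j)%N -> mul A B j (Some (iota x, s)) <> None.
  move=> j0; rewrite ex;
    apply: (near_infinity_not_torsion two_neq0 smooth maxO u0) => //.
  by rewrite -ex.
case eN : (mul A B N (Some (iota x, s))) => [[a y]|]; last exact: (nt N N0 eN).
move: tw tws; rewrite eN => -[_ [b Kb eb]] [_ [b' Kb' eb']].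
(* The ordinate of N P is both b and b' s with b and b' in [KK]. A nonzero b' would put s into [KK],
   so the ordinate is 0 and 2 N P = 0, contradicting [nt]. *)
have b'0 : b' = 0.
  apply/eqP; apply: contrapT => /negP b'0; apply: nKs.
  have [_ _ hd] := fK; rewrite (_ : s = b / b'); first exact: hd.
  by apply: (mulfI b'0); rewrite -eb' eb mulr1 mulrC divfK.
apply: (nt (N + N)%N); first by rewrite addn_gt0 N0.
rewrite (mulD two_neq0 smooth) // eN eb' b'0 mul0r.
by rewrite /= oppr0 !eqxx.
Qed.

Lemma quadratic_escape (Gamma : point EK -> Prop) :
  finitely_generated Gamma -> has_extension_escaping (saturation Gamma) 2.
Proof.
move=> [n [g hG]]; have [x [s [es esc]]] := exists_escaping_point g.
pose d := cubic (short2 E) (short4 E) (short6 E) x.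
have ed : s ^+ 2 = iota d.
  by rewrite es /d /cubic eA eB eC; ring.
have [q [irr rt sz]] := exists_sqrt_minpoly ed.
have q0 := irredp_neq0 irr.
pose L := SubFieldExtType rt irr.
pose j : {rmorphism L -> kbar} := @subfx_inj k kbar iota s q.
have jk (a : k) : j (in_alg L a) = iota a by exact: subfx_inj_base.
exists L, j, jk; split.
  by rewrite dimvf.
(* The adjoined square root with the completion of the square undone. *)
pose y0 := subfx_root iota s q - in_alg L ((a1 E * x + a3 E) / 2%:R) : L.
have ey : j y0 = s - (iota (a1 E) * iota x + iota (a3 E)) / 2%:R.
  rewrite /y0 rmorphB jk rmorphM rmorphD rmorphM fmorphV rmorph_nat; congr (_ - _).
  exact: subfx_inj_root.
have on : on_curve (base_change (in_alg L) E) (Some (in_alg L x, y0)).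
  have : on_curve EK (Some (iota x, j y0)).
    rewrite complete_on // /complete ey /= subrK; exact/eqP.
  rewrite /= -!jk -!rmorphM -!rmorphXn -!rmorphD -!rmorphM -!rmorphD.
  by rewrite (inj_eq (fmorph_inj j)).
move=> all; have [m [m0 hm]] := all (Point on).
apply: (esc (point_map jk (Point on)) _ m m0); last exact/hG.
by rewrite /= jk ey subrK.
Qed.
End Escape.

Theorem theorem3p2 (k : fieldType) (char0 : [pchar k] =i pred0)
    (kbar : closedFieldType) (iota : {rmorphism k -> kbar})
    (kbarP : is_algebraic_closure iota)
    (E : elliptic_curve k)
    (Gamma : point (base_change iota E) -> Prop)
    (Gamma_subgroup : is_subgroup Gamma)
    (Gamma_fg : finitely_generated Gamma) :
  has_extension_escaping (saturation Gamma) 18 /\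
  (number_field k -> has_extension_escaping (saturation Gamma) 2).
Proof.
have esc := quadratic_escape char0 Gamma_fg; split=> //.
case: esc => L [j [jk [le h]]]; exists L, j, jk; split=> //.
exact: leq_trans le _.
Qed.
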